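(* Consider a finite-space SSP game (as in the context) satisfying the Finite-Space SSP Game Model Assumption, and the Q-learning algorithm described in the context. Suppose algorithmic conditions (i), (ii), (iii) and (v) hold. Then for any given initial $Q_0$, the sequence $\{Q_t\}$ generated by the Q-learning algorithm is bounded with probability 1.
   Context: Finite-space game: $S=\{1,\dots,n\}$, $S_o=S\cup\{0\}$, $0$ absorbing cost-free termination state. At $i\in S$, players I and II have finite control sets $U(i),V(i)$; under $(u,v)$ the state moves to $j\in S_o$ w.p. $p_{ij}(u,v)$ with (deterministic, real) transition cost $\hat g(i,u,v,j)$ paid by player I to player II. $J(i;\pi_1,\pi_2)=\liminf_{t\to\infty}E_{\pi_1\pi_2}[\sum_{k=0}^t\hat g(i_k,u_k,v_k,i_{k+1})\mid i_0=i]$ for history-dependent randomized policies $\pi_1,\pi_2$. $\bar U(i)=\mathcal P(U(i))$, $\bar V(i)=\mathcal P(V(i))$; $\Pi_{1,SR},\Pi_{2,SR}$: stationary randomized policies. A pair of policies is prolonging if for some initial state the termination state is with positive probability never reached. Finite-Space SSP Game Model Assumption: (i) there is $\bar\mu\in\Pi_{1,SR}$ with $J(i;\bar\mu,\nu)<+\infty$ for all $\nu\in\Pi_{2,SR}$, all $i$; (ii) there is $\bar\nu\in\Pi_{2,SR}$ with $J(i;\mu,\bar\nu)>-\infty$ for all $\mu\in\Pi_{1,SR}$, all $i$; (iii) every prolonging pair in $\Pi_{1,SR}\times\Pi_{2,SR}$ has $J(i;\mu,\nu)\in\{+\infty,-\infty\}$ for some $i$. Q-learning: $R=\{(i,u,v):i\in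 S,u\in U(i),v\in V(i)\}$; set $U(0)=V(0)=\{0\}$ and treat Q-factor vectors $Q$ as indexed by $R\cup\{(0,0,0)\}$ with $Q(0,0,0)=0$. For a vector $Q$, state $s$, $\rho\in\mathcal P(U(s))$, $\sigma\in\mathcal P(V(s))$: $\underline Q(s,\rho,\sigma)=\sum_{\tilde u,\tilde v}\rho(\tilde u)\sigma(\tilde v)Q(s,\tilde u,\tilde v)$ (equal to $0$ when $s=0$). All variables live on a probability space $(\Omega,\mathcal F,\mathbf P)$ with a filtration $\{\mathcal F_t\}$. Given $Q_0$ and $\{Q_\tau,\tau\le t\}$, for each $\ell=(i,u,v)\in R$: a stepsize $\gamma_{t,\ell}\in[0,1]$, integers $0\le\tau_{\ell\tilde\ell}(t)\le t$ for $\tilde\ell\in R$, and a random successor state $j_t^\ell\in S_o$ are given; with $Q_t^{(\ell)}(\tilde\ell)=Q_{\tau_{\ell\tilde\ell}(t)}(\tilde\ell)$ and $s=j_t^\ell$, $Q_{t+1}(i,u,v)=(1-\gamma_{t,\ell})Q_t(i,u,v)+\gamma_{t,\ell}\big(\hat g(i,u,v,s)+\inf_{\rho\in\bar U(s)}\sup_{\sigma\in\bar V(s)}\underline{Q}^{(\ell)}_t(s,\rho,\sigma)\big)$. Algorithmic conditions: (i) $Q_0$ is $\mathcal F_0$-measurable; (ii) $\gamma_{t,\ell}$ and $\tau_{\ell\tilde\ell}(t)$ are $\mathcal F_t$-measurable; (iii) $j_t^\ell$ is $\mathcal F_{t+1}$-measurable and $\mathbf P(j_t^\ell=j\mid\mathcal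 F_t)=p_{ij}(u,v)$ for $j\in S_o$, $\ell=(i,u,v)$; (iv) w.p.1, $\lim_{t\to\infty}\tau_{\ell\tilde\ell}(t)=\infty$ for all $\ell,\tilde\ell\in R$; (v) w.p.1, $\sum_t\gamma_{t,\ell}=\infty$ and $\sum_t\gamma_{t,\ell}^2<\infty$ for all $\ell\in R$. *)

(* Defs.v *)
From HB Require Import structures.
From mathcomp Require Import all_boot all_order all_algebra.
From mathcomp Require Import all_classical all_reals all_analysis.
Unset Printing Implicit Defensive.
Import Order.TTheory GRing.Theory Num.Theory.
Import numFieldNormedType.Exports.
Local Open Scope classical_set_scope.
Local Open Scope ring_scope.

(* States S = {1,..,n} are represented by 'I_n; the extended state     *)
(* space S_o = S u {0} by option 'I_n, with None the termination       *)
(* state 0.  U i, V i : finite control sets of players I and II.       *)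

Section Game.
Context {R : realType} {n : nat} {U V : 'I_n -> finType}.

Definition isDist {A : finType} (f : {ffun A -> R}) :=
  (forall a, 0 <= f a) /\ \sum_(a : A) f a = 1.

Definition transition_kernel (p : forall i : 'I_n, U i -> V i -> option 'I_n -> R) :=
  forall i u v, (forall j, 0 <= p i u v j) /\ \sum_(j : option 'I_n) p i u v j = 1.

Definition SRpolicy1 (mu : forall i : 'I_n, {ffun U i -> R}) := forall i, isDist (mu i).
Definition SRpolicy2 (nu : forall i : 'I_n, {ffun V i -> R}) := forall i, isDist (nu i).

Variables (p g : forall i : 'I_n, U i -> V i -> option 'I_n -> R).
Variables (mu : forall i : 'I_n, {ffun U i -> R}) (nu : forall i : 'I_n, {ffun V i -> R}).

(* expected cost  E[ sum_{k=0}^t g(i_k,u_k,v_k,i_{k+1}) | i_0 = i ]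
   under the stationary randomized pair (mu, nu); state 0 is absorbing
   and cost-free, hence contributes 0. *)
Fixpoint exp_cost (t : nat) (i : 'I_n) : R :=
  \sum_(u : U i) \sum_(v : V i) mu i u * nu i v *
    \sum_(j : option 'I_n) p i u v j *
      (g i u v j + match t with
                   | 0 => 0
                   | t'.+1 => match j with Some j' => exp_cost t' j' | None => 0 end
                   end).

Definition Jcost (i : 'I_n) : \bar R := limn_einf (fun t => (exp_cost t i)%:E).

Fixpoint not_term (t : nat) (i : 'I_n) : R :=
  match t with
  | 0 => 1
  | t'.+1 => \sum_(u : U i) \sum_(v : V i) mu i u * nu i v *
               \sum_(j : 'I_n) p i u v (Some j) * not_term t' j
  end.

(* (mu, nu) is prolonging: for some initial state the probability of never
   reaching 0, i.e. P(forall t, i_t <> 0) = inf_t P(i_t <> 0), is positive *)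
Definition prolonging : Prop :=
  exists i : 'I_n, 0 < inf (range (fun t => not_term t i)).

End Game.

Definition SSP_assumption {R : realType} {n : nat} {U V : 'I_n -> finType}
  (p g : forall i : 'I_n, U i -> V i -> option 'I_n -> R) : Prop :=
  (exists mub, SRpolicy1 mub /\
     forall nu, SRpolicy2 nu -> forall i, (Jcost p g mub nu i < +oo)%E) /\
  (exists nub, SRpolicy2 nub /\
     forall mu, SRpolicy1 mu -> forall i, (-oo < Jcost p g mu nub i)%E) /\
  (forall mu nu, SRpolicy1 mu -> SRpolicy2 nu -> prolonging p mu nu ->
     exists i, Jcost p g mu nu i = +oo%E \/ Jcost p g mu nu i = -oo%E).

Definition Ridx {n : nat} (U V : 'I_n -> finType) := {i : 'I_n & (U i * V i)%type}.

(* inf_{rho in P(U s)} sup_{sigma in P(V s)} sum rho(u) sigma(v) Q(s,u,v);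
   equal to 0 for the termination state s = 0 (since Q(0,0,0) = 0). *)
Definition minmax_val {R : realType} {n : nat} (U V : 'I_n -> finType)
  (Q : Ridx U V -> R) (s : option 'I_n) : R :=
  match s with
  | None => 0
  | Some s' =>
      inf [set x | exists rho : {ffun U s' -> R}, isDist rho /\
        x = sup [set y | exists sigma : {ffun V s' -> R}, isDist sigma /\
              y = \sum_(u : U s') \sum_(v : V s') rho u * sigma v *
                    Q (existT _ s' (u, v))]]
  end.

Definition measurable_wrt_R {T : Type} {R : realType} (G : set (set T)) (X : T -> R) :=
  forall B : set R, measurable B -> G (X @^-1` B).
Definition measurable_wrt_discrete {T A : Type} (G : set (set T)) (X : T -> A) :=
  forall a : A, G (X @^-1` [set a]).

Definition filtration {d} {T : measurableType d} (F : nat -> set (set T)) :=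
  (forall t, sigma_algebra setT (F t)) /\
  (forall t, F t `<=` measurable) /\
  (forall t, F t `<=` F t.+1).

(* Main.v *)
(* The stationary policy of player I in condition (i) of the game model and that
   of player II in condition (ii) form a non-prolonging pair.
   Fixing the policy [nu] of player II leaves player I a decision process that
   has a strict subsolution: some [h] with [h + e <= r_u + P_u h] for all controls
   [u].  Otherwise Gordan's alternative gives an invariant measure of nonpositive
   average cost; the policy it induces on its support, completed by the
   non-prolonging one, is prolonging and has bounded costs, against (iii).
   Robbins-Monro averaging of the bounded noise
   [g (j_t) + h (j_t) - E (g (j_t) + h (j_t))] gives [E_t], which is almost surely
   eventually smaller than [e], and with [m = E (g (j_t) + h (j_t))] the
   inequality [Q_t >= m + E_t - C] propagates along the iteration: the strictness
   [e] absorbs [E_t] whatever the delays are.  Exchanging the players and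
   negating the costs gives the upper bound. *)
Require Import Defs.
From HB Require Import structures.
From mathcomp Require Import all_boot all_order all_algebra.
From mathcomp Require Import all_classical all_reals all_analysis.
From mathcomp Require Import measurable_realfun.
From mathcomp Require Import ring lra.
Import Order.TTheory GRing.Theory Num.Theory.
Import numFieldNormedType.Exports.
Local Open Scope classical_set_scope.
Local Open Scope ring_scope.

Set Implicit Arguments.
Unset Strict Implicit.

(** * Gordan's alternative *)

(** Each strict inequality survives a small enough [d], and shrinking [d] never destroys one already
    secured, so a finite list admits a common [d]. *)
Lemma exists_pos_perturbation (R : realFieldType) (I : eqType) (a b : I -> R)
    (r : seq I) :
  (forall i, i \in r -> 0 < a i) ->
  exists2 d, 0 < d & forall i, i \in r -> 0 < a i + d * b i.
Proof.
elim: r => [_|k r IHr a_gt0]; first by exists 1.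
have [i ir|d d0 dP] := IHr; first by apply: a_gt0; rewrite inE ir orbT.
have ak : 0 < a k by apply: a_gt0; rewrite inE eqxx.
(* The [+ 1] keeps the denominator positive when [b k] is 0. *)
pose d' := Num.min d (a k / (`|b k| + 1)).
have bk1 : 0 < `|b k| + 1 by rewrite ltr_wpDl.
have d'0 : 0 < d' by rewrite lt_min d0 divr_gt0.
have d'P i e : 0 < a i -> 0 < a i + e * b i -> d' <= e -> 0 < a i + d' * b i.
  move=> ai aie d'e; have [bi|bi] := leP 0 (b i).
    by rewrite ltr_wpDr// mulr_ge0// ltW.
  by apply: (lt_le_trans aie); rewrite lerD2l ler_wnM2r// ltW.
exists d' => // i; rewrite inE => /orP[/eqP->|ir].
  apply: (d'P k (a k / (`|b k| + 1))) => //; last by rewrite ge_min lexx orbT.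
  rewrite mulrAC -[X in X + _](@mulfK _ (`|b k| + 1)) ?gt_eqF// -mulrDl.
  by rewrite divr_gt0// -mulrDr mulr_gt0//; have := ler_norm (- b k); rewrite normrN; lra.
apply: (d'P i d) => //; first by apply: a_gt0; rewrite inE ir orbT.
  exact: dP.
by rewrite ge_min lexx.
Qed.

(* Induction on [r]: if the head [y k] is not already on the positive side of
   the functional found for the tail, project the tail along [y k]. *)
Lemma gordan (R : realFieldType) (m : nat) (I : eqType) (y : I -> 'rV[R]_m)
    (r : seq I) : uniq r ->
  (exists z : 'cV[R]_m, forall i, i \in r -> 0 < (y i *m z) 0 0) \/
  (exists l : I -> R, [/\ forall i, 0 <= l i, exists2 i, i \in r & 0 < l i &
     \sum_(i <- r) l i *: y i = 0]).
Proof.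
elim: r y => [y _|k r IHr y /= /andP[kr ur]]; first by left; exists 0.
have sum_but (l : I -> R) c (f : I -> 'rV[R]_m) :
    \sum_(i <- r) (if i == k then c else l i) *: f i = \sum_(i <- r) l i *: f i.
  apply: eq_big_seq => i ir; case: eqP => // ik.
  by move: kr; rewrite -ik ir.
have [[z zP]|[l [l0 [i ir li] ls]]] := IHr y ur; last first.
  right; exists (fun i => if i == k then 0 else l i); split.
  - by move=> j; case: ifP.
  - exists i; first by rewrite inE ir orbT.
    by case: eqP => // ik; move: kr; rewrite -ik ir.
  - by rewrite big_cons eqxx scale0r add0r sum_but.
have [zk|zk] := ltP 0 ((y k *m z) 0 0).
  by left; exists z => i; rewrite inE => /orP[/eqP->//|/zP].
have [yk0|yk0] := eqVneq (y k) 0.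
  right; exists (fun i => if i == k then 1 else 0); split.
  - by move=> j; case: ifP.
  - by exists k; rewrite ?inE eqxx.
  - rewrite big_cons eqxx yk0 scaler0 add0r (sum_but (fun=> 0)).
    by rewrite big1// => i _; rewrite scale0r.
pose q (x : 'rV[R]_m) := (x *m (y k)^T) 0 0.
have n0 : 0 < q (y k).
  have qE : q (y k) = \sum_j (y k 0 j) ^+ 2.
    by rewrite /q mxE; apply: eq_bigr => j _; rewrite mxE.
  rewrite lt_neqAle qE sumr_ge0 ?andbT => [|j _]; last exact: sqr_ge0.
  apply: contra yk0; rewrite eq_sym psumr_eq0 => [/allP h|j _]; last exact: sqr_ge0.
  apply/eqP/rowP => j; rewrite mxE; apply/eqP; rewrite -sqrf_eq0.
  exact: (h j (mem_index_enum _)).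
pose y' i := y i - (q (y i) / q (y k)) *: y k.
have [[z' zP']|[l [l0 [i ir li] ls]]] := IHr y' ur.
  (* Correcting [z'] along [y k] makes its product with [y k] vanish and its product with [y i] that
     of [y' i] with [z']. A small multiple of [y k] then makes index [k] positive too. *)
  left; pose z'' := z' - ((y k *m z') 0 0 / q (y k)) *: (y k)^T.
  have dotE i e : (y i *m (z'' + e *: (y k)^T)) 0 0 =
      (y' i *m z') 0 0 + e * q (y i).
    rewrite /z'' /y' !mulmxDr !mulmxDl mulmxN mulNmx -!scalemxAr -!scalemxAl.
    have addE (A B : 'M[R]_1) : (A + B) 0 0 = A 0 0 + B 0 0 by rewrite mxE.
    have oppE (A : 'M[R]_1) : (- A) 0 0 = - A 0 0 by rewrite mxE.
    have scaleE x (A : 'M[R]_1) : (x *: A) 0 0 = x * A 0 0 by rewrite mxE.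
    rewrite !(addE, oppE, scaleE) -/(q (y i)).
    by field; rewrite gt_eqF.
  have [d d0 dP] := @exists_pos_perturbation _ _ _ (fun i => q (y i)) _ zP'.
  exists (z'' + d *: (y k)^T) => i; rewrite inE dotE => /orP[/eqP->|/dP//].
  rewrite [y' k](_ : _ = 0) ?mul0mx ?mxE ?add0r ?mulr_gt0//.
  by rewrite /y' divff ?gt_eqF// scale1r subrr.
pose c := \sum_(i <- r) l i * (q (y i) / q (y k)).
have lsE : \sum_(i <- r) l i *: y i = c *: y k.
  apply/eqP; rewrite -subr_eq0 /c scaler_suml -sumrB -[X in _ == X]ls; apply/eqP.
  by apply: eq_bigr => j _; rewrite scalerBr scalerA.
have [c0|c0] := leP c 0.
  right; exists (fun i => if i == k then - c else l i); split.
  - by move=> j; case: ifP; rewrite ?oppr_ge0.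
  - exists i; first by rewrite inE ir orbT.
    by case: eqP => // ik; move: kr; rewrite -ik ir.
  - by rewrite big_cons eqxx sum_but lsE scaleNr addNr.
(* The functional [z] found for the tail is positive on this combination but nonpositive on [y k],
   so [c] cannot be positive. *)
exfalso; have : 0 < ((\sum_(i <- r) l i *: y i) *m z) 0 0.
  rewrite mulmx_suml summxE (big_rem i)//= ltr_pwDl//.
    by rewrite -scalemxAl mxE mulr_gt0// zP.
  rewrite big_seq sumr_ge0// => j /mem_rem jr.
  by rewrite -scalemxAl mxE mulr_ge0// ltW// zP.
by rewrite lsE -scalemxAl mxE pmulr_rgt0// ltNge zk.
Qed.

(** * Cumulated costs of substochastic chains *)

Section SubstochasticMatrix.
Variables (R : realType) (n : nat) (P : 'M[R]_n).
Hypothesis P_ge0 : forall i j, 0 <= P i j.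
Hypothesis P_le1 : forall i, \sum_j P i j <= 1.

Definition cum_cost (g : 'cV[R]_n) t : 'cV[R]_n := iter t (fun c => g + P *m c) 0.

(** The mass missing from the rows of [P] is absorbed by termination, so [P^t 1] is the probability
    of still running after [t] steps. *)
Definition survival t : 'cV[R]_n := iter t (mulmx P) (const_mx 1).

Lemma mulmx_substoch_bound (h : 'cV[R]_n) M : 0 <= M ->
  (forall i, `|h i 0| <= M) -> forall i, `|(P *m h) i 0| <= M.
Proof.
move=> M0 hM i; rewrite mxE (le_trans (ler_norm_sum _ _ _))//.
have -> : M = 1 * M by rewrite mul1r.
apply: le_trans (ler_wpM2r M0 (P_le1 i)); rewrite mulr_suml ler_sum// => j _.
by rewrite normrM ger0_norm// ler_wpM2l.
Qed.

Lemma iter_substoch_bound (h : 'cV[R]_n) M t : 0 <= M ->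
  (forall i, `|h i 0| <= M) -> forall i, `|(iter t (mulmx P) h) i 0| <= M.
Proof. by move=> M0 hM; elim: t => //= t; exact: mulmx_substoch_bound. Qed.

Lemma col_bound (h : 'cV[R]_n) : exists2 M, 0 <= M & forall i, `|h i 0| <= M.
Proof.
exists (\sum_i `|h i 0|); first by rewrite sumr_ge0.
by move=> i; rewrite (bigD1 i)//= lerDl sumr_ge0.
Qed.

(* [I - P] is injective on its range, as [P] is power bounded. *)
Lemma substoch_ergodic_splitting (g : 'cV[R]_n) :
  exists a h : 'cV[R]_n, P *m a = a /\ g = a + h - P *m h.
Proof.
(* The transpose is there because subspaces are row spaces: the rows of [C] span the range of
   [I - P]. *)
pose C : 'M[R]_n := (1%:M - P)^T.
have ker0 : (C :&: kermx C)%MS = 0.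
  apply/eqP/rowV0P => x; rewrite sub_capmx => /andP[/submxP[y xy] /sub_kermxP xC].
  pose X := x^T; pose Y := y^T.
  have XY : X = Y - P *m Y.
    by rewrite /X xy trmx_mul trmxK mulmxBl mul1mx.
  have PX : P *m X = X.
    apply/eqP; rewrite eq_sym -subr_eq0; apply/eqP; apply: trmx_inj; rewrite trmx0 -xC.
    by rewrite /C linearB/= trmx_mul trmxK linearB/= trmx1 mulmxBr mulmx1.
  (* A fixed vector [X = Y - P Y] telescopes to [t X = Y - P^t Y], which stays bounded in [t]; hence
     [X = 0]. *)
  have tX t : X *+ t = Y - iter t (mulmx P) Y.
    elim: t => [|t IHt]; first by rewrite mulr0n subrr.
    rewrite iterS; have -> : iter t (mulmx P) Y = Y - X *+ t by rewrite IHt opprB addrC subrK.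
    by rewrite mulmxBr -[X *+ t]scaler_nat -scalemxAr PX scaler_nat opprB addrCA -XY mulrSr.
  have [M M0 YM] := col_bound Y.
  have scaleE c (A : 'cV[R]_n) i : (c *: A) i 0 = c * A i 0 by rewrite mxE.
  have subE (A B : 'cV[R]_n) i : (A - B) i 0 = A i 0 - B i 0 by rewrite !mxE.
  have tM t i : t%:R * `|X i 0| <= M + M.
    have -> : t%:R * `|X i 0| = `|(X *+ t) i 0|.
      by rewrite -[X *+ t]scaler_nat scaleE normrM normr_nat.
    rewrite tX subE (le_trans (ler_normB _ _))// lerD//.
    exact: iter_substoch_bound.
  apply: trmx_inj; rewrite trmx0; apply/colP => i; rewrite [RHS]mxE.
  apply/eqP; rewrite -normr_eq0; apply/negPn/negP => Xi0.
  have Xi : 0 < `|X i 0| by rewrite lt_neqAle eq_sym Xi0 normr_ge0.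
  have := tM (Num.truncn ((M + M) / `|X i 0|)).+1 i; apply/negP; rewrite -ltNge.
  by rewrite -ltr_pdivrMr// truncnS_gt.
(* Range and kernel meet trivially, so squaring [C] preserves its rank and its row space. *)
have CC : (C <= C *m C)%MS.
  rewrite -(mxrank_leqif_sup (submxMl C C)) eqn_leq mxrankS ?submxMl//=.
  by rewrite -{1}(mxrank_mul_ker C C) ker0 mxrank0 addn0.
have /submxP[D gD] : (g^T *m C <= C *m C)%MS by rewrite (submx_trans (submxMl _ _)).
pose h := D^T; pose a := g - (h - P *m h).
exists a, h; split; last by rewrite /a -addrA subrK.
apply/eqP; rewrite eq_sym -subr_eq0 -{1}[a]mul1mx -mulmxBl.
have -> : 1%:M - P = C^T by rewrite trmxK.
have -> : a = g - C^T *m h by rewrite /a trmxK mulmxBl mul1mx.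
rewrite mulmxBr -[X in X - _]trmxK trmx_mul trmxK gD trmx_mul trmx_mul mulmxA.
by rewrite subrr.
Qed.

(** By the splitting, the cumulated cost is [t a] plus the bounded term [h - P^t h]. A condition on
    a liminf thus becomes a sign condition on the gain [a], and then a bound at all times. *)
Lemma cum_cost_linear_growth (g : 'cV[R]_n) : exists (a : 'cV[R]_n) (B : R),
  forall t i, `|cum_cost g t i 0 - t%:R * a i 0| <= B.
Proof.
have [a [h [Pa gE]]] := substoch_ergodic_splitting g.
have [M M0 hM] := col_bound h.
have cE t : cum_cost g t = a *+ t + (h - iter t (mulmx P) h).
  elim: t => [|t IHt]; first by rewrite /= mulr0n subrr addr0.
  rewrite /cum_cost iterS -/(cum_cost g t) IHt mulmxDr mulmxBr {1}gE.
  rewrite -[a *+ t]scaler_nat -scalemxAr Pa scaler_nat /= mulrS.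
  have cancel_mid (x y z u v : 'cV[R]_n) : x + y - z + (u + (z - v)) = x + u + (y - v).
    by apply/colP => i; rewrite !mxE; ring.
  exact: cancel_mid.
exists a, (M + M) => t i; rewrite cE -[a *+ t]scaler_nat !mxE addrAC subrr add0r.
by rewrite (le_trans (ler_normB _ _))// lerD// iter_substoch_bound.
Qed.

End SubstochasticMatrix.

(** * Strict subsolutions *)

Lemma big_option (R : nmodType) (X : finType) (f : option X -> R) :
  \sum_o f o = f None + \sum_x f (Some x).
Proof.
rewrite (bigD1 None)//=; congr (_ + _).
rewrite (reindex_omap Some id) => [|[x|]//].
by apply: eq_bigl => x; rewrite /= eqxx.
Qed.

Section DecisionProcess.
Variables (R : realType) (n : nat) (A : 'I_n -> finType).
Variables (q : forall i, A i -> 'I_n -> R) (r : forall i, A i -> R).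
Hypothesis q_ge0 : forall i a j, 0 <= @q i a j.
Hypothesis q_le1 : forall i a, \sum_j @q i a j <= 1.

Implicit Type m : forall i, {ffun A i -> R}.

Definition pol_mx m : 'M[R]_n := \matrix_(i, j) \sum_a m i a * q a j.
Definition pol_cost m : 'cV[R]_n := \col_i \sum_a m i a * r a.

Lemma pol_mx_ge0 m : SRpolicy1 m -> forall i j, 0 <= pol_mx m i j.
Proof.
move=> mP i j; rewrite mxE sumr_ge0// => a _; rewrite mulr_ge0//.
by have [/(_ a)] := mP i.
Qed.

Lemma pol_mx_le1 m : SRpolicy1 m -> forall i, \sum_j pol_mx m i j <= 1.
Proof.
move=> mP i; have [m0 m1] := mP i; rewrite -m1.
under eq_bigr do rewrite mxE.
rewrite exchange_big/= ler_sum// => a _; rewrite -mulr_sumr.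
by rewrite ler_piMr.
Qed.

Lemma pol_mxE m (c : 'cV[R]_n) i :
  (pol_mx m *m c) i 0 = \sum_a m i a * \sum_j q a j * c j 0.
Proof.
rewrite mxE; under eq_bigr do rewrite mxE mulr_suml.
rewrite exchange_big/=; apply: eq_bigr => a _; rewrite mulr_sumr.
by apply: eq_bigr => j _; rewrite mulrA.
Qed.

Lemma mono_mulmx (P : 'M[R]_n) (c d : 'cV[R]_n) : (forall i j, 0 <= P i j) ->
  (forall i, c i 0 <= d i 0) -> forall i, (P *m c) i 0 <= (P *m d) i 0.
Proof.
by move=> P0 cd i; rewrite !mxE ler_sum// => j _; rewrite ler_wpM2l.
Qed.

(** For [w = 2 (1 + P 1 + ... + P^(N-1) 1)] the difference [P w - w] telescopes to [2 (P^N 1 - 1)],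
    which is at most -1. Then [w >= 1] because [P w >= 0]. *)
Lemma proper_weight (P : 'M[R]_n) N : (forall i j, 0 <= P i j) ->
  (forall i, survival P N i 0 <= 1 / 2) ->
  exists w : 'cV[R]_n, forall i, 1 <= w i 0 /\ (P *m w) i 0 <= w i 0 - 1.
Proof.
move=> P0 PN; pose nt := survival P.
pose w : 'cV[R]_n := 2 *: \sum_(k < N) nt k.
have nt0 k i : 0 <= nt k i 0.
  elim: k i => [|k IHk] i; first by rewrite mxE.
  by rewrite /= mxE sumr_ge0// => j _; rewrite mulr_ge0.
have w0 i : 0 <= w i 0.
  by rewrite mxE mulr_ge0// summxE sumr_ge0.
have Pw i : (P *m w) i 0 <= w i 0 - 1.
  have PwE : P *m w = w + 2 *: (nt N - nt 0).
    rewrite -scalemxAr mulmx_sumr -scalerDr; congr (_ *: _).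
    elim: (N) => [|k IHk]; first by rewrite !big_ord0 subrr addr0.
    rewrite !big_ord_recr/= IHk -!addrA; congr (_ + (_ + _)).
    by rewrite addrC.
  rewrite PwE mxE lerD2l.
  have -> : (2 *: (nt N - nt 0)) i 0 = 2 * (nt N i 0 - 1) by rewrite !mxE.
  by have := PN i; rewrite -/(nt N); lra.
exists w => i; split => //.
have Pw0 : 0 <= (P *m w) i 0 by rewrite mxE sumr_ge0// => j _; rewrite mulr_ge0.
by have := Pw i; lra.
Qed.

(* If the alternative measure [lam] exists, the policy [m] it induces has
   [lam]-averaged costs [<= 0]; being bounded below, the costs are then bounded on
   the support [L > 0], and the weight [w] bounds them elsewhere. *)
Lemma mdp_strict_subsolution :
  (exists m0, SRpolicy1 m0 /\
    exists N, forall i, survival (pol_mx m0) N i 0 <= 1 / 2) ->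
  (forall m, SRpolicy1 m -> exists M, forall t i,
     - M <= cum_cost (pol_mx m) (pol_cost m) t i 0) ->
  (forall m i, SRpolicy1 m ->
     (forall t, survival (pol_mx m) t i 0 = 1) ->
     ~ exists M, forall t j, cum_cost (pol_mx m) (pol_cost m) t j 0 <= M) ->
  exists (h : 'I_n -> R) (e : R), 0 < e /\
    forall i (a : A i), h i + e <= r a + \sum_j q a j * h j.
Proof.
move=> [m0 [m0P [N m0N]]] lowm prolm.
pose X := {i : 'I_n & A i}.
(* A functional on the vectors [y] is a function on states together with a weight on cost. The extra
   vector [(0, 1)] forces that weight to be positive, and dividing by it yields [h]. *)
pose x (l : X) : 'rV[R]_n := \row_j (q (tagged l) j - (tag l == j)%:R).
pose y (o : option X) : 'rV[R]_(n + 1) :=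
  if o is Some l then row_mx (x l) (r (tagged l))%:M else row_mx 0 1%:M.
have [[z zP]|[l [l0 [k _ lk] ls]]] := gordan y (index_enum_uniq (option X)).
  pose z1 := usubmx z; pose z2 := dsubmx z 0 0.
  have dotE (u : 'rV[R]_n) b : (row_mx u b%:M *m z) 0 0 = (u *m z1) 0 0 + b * z2.
    rewrite -{1}[z]vsubmxK mul_row_col mxE; congr (_ + _).
    by rewrite mul_scalar_mx mxE.
  have z20 : 0 < z2.
    by have := zP None (mem_index_enum _); rewrite /y dotE mul0mx mxE add0r mul1r.
  have hP i (a : A i) : 0 < r a + \sum_j q a j * (z1 j 0 / z2) - z1 i 0 / z2.
    have := zP (Some (Tagged A a)) (mem_index_enum _); rewrite /y dotE.
    have -> : (x (Tagged A a) *m z1) 0 0 = \sum_j q a j * z1 j 0 - z1 i 0.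
      rewrite mxE; under eq_bigr do rewrite mxE mulrBl.
      rewrite sumrB; congr (_ - _); rewrite (bigD1 i)//= eqxx mul1r big1 ?addr0//.
      by move=> j ji; rewrite eq_sym (negPf ji) mul0r.
    rewrite -(pmulr_lgt0 _ (_ : 0 < z2^-1)) ?invr_gt0//.
    congr (_ < _); rewrite !mulrDl mulfK ?gt_eqF// mulr_suml mulNr addrC addrA.
    by congr (_ + _ - _); apply: eq_bigr => j _; rewrite mulrA.
  have [e e0 eP] := @exists_pos_perturbation _ _
    (fun l : X => r (tagged l) + \sum_j q (tagged l) j * (z1 j 0 / z2) - z1 (tag l) 0 / z2)
    (fun=> -1) (index_enum X) (fun l _ => hP _ _).
  exists (fun j => z1 j 0 / z2), e; split => // i a.
  by have := eP (Tagged A a) (mem_index_enum _); rewrite /=; lra.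
(* In the other alternative [lam] is a measure on state-control pairs with state marginal [L]. The
   first [n] coordinates of the relation express invariance, the last one that the total cost is
   [- l None]. *)
pose lam i (a : A i) := l (Some (Tagged A a)).
pose L i := \sum_a lam i a.
have lam_ge0 i a : 0 <= lam i a by exact: l0.
have L0 i : 0 <= L i by rewrite sumr_ge0.
have lamle i a : lam i a <= L i.
  by rewrite /L (bigD1 a)//= lerDl sumr_ge0.
have balance j : \sum_i \sum_a lam i a * q a j = L j.
  have := congr1 (fun v : 'rV[R]_(n + 1) => v 0 (lshift 1 j)) ls.
  rewrite summxE big_option [in X in X = _]mxE row_mxEl mxE mulr0 add0r [RHS]mxE.
  rewrite (sig_big_dep _ _ (fun i (a : A i) => lam i a * q a j))/= => lsE.
  apply/eqP; rewrite -subr_eq0 -[X in _ == X]lsE {lsE}.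
  have -> : L j = \sum_(p : X) lam _ (tagged p) * (tag p == j)%:R.
    rewrite -(sig_big_dep xpredT (fun=> xpredT) (fun i (a : A i) => lam i a * (i == j)%:R))/=.
    rewrite (bigD1 j)//= [X in _ + X]big1 ?addr0.
      by apply: eq_bigr => a _; rewrite eqxx mulr1.
    by move=> i ij; rewrite big1// => a _; rewrite (negPf ij) mulr0.
  rewrite -sumrB; apply/eqP/eq_bigr => -[i a] _.
  by rewrite [RHS]mxE row_mxEl mxE mulrBr.
have cost_le0 : \sum_i \sum_a lam i a * r a = - l None.
  have := congr1 (fun v : 'rV[R]_(n + 1) => v 0 (rshift n 0)) ls.
  rewrite summxE big_option [in X in X = _]mxE row_mxEr mxE mulr1 [RHS]mxE.
  rewrite (sig_big_dep _ _ (fun i (a : A i) => lam i a * r a))/= => /eqP.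
  rewrite addrC addr_eq0 => /eqP <-; apply: eq_bigr => -[i a] _.
  by rewrite [RHS]mxE row_mxEr mxE mulr1n.
(* If only [l None] were positive, the total cost would be both zero and negative. *)
have [i0 Li0] : exists i, 0 < L i.
  case: k lk => [[i a]|] lk; first by exists i; exact: lt_le_trans lk (lamle i a).
  apply: contrapT => nL.
  have lam0 i a : lam i a = 0.
    apply/eqP; rewrite eq_le l0 andbT (le_trans (lamle i a))// leNgt.
    by apply/negP => Li; apply: nL; exists i.
  move: cost_le0; rewrite big1 => [/eqP|i _]; last first.
    by rewrite big1// => a _; rewrite lam0 mul0r.
  by rewrite eq_sym oppr_eq0 gt_eqF.
(* The law of the control given the state under [lam], with [m0] off the support. *)
pose m i : {ffun A i -> R} := if L i == 0 then m0 i else [ffun a => lam i a / L i].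
have mP : SRpolicy1 m.
  move=> i; rewrite /m; case: eqP => [_//|/eqP Li]; split.
    by move=> a; rewrite ffunE divr_ge0.
  by under eq_bigr do rewrite ffunE; rewrite -mulr_suml divff.
have LmE i a : L i * m i a = lam i a.
  rewrite /m; case: eqP => [Li|/eqP Li]; last by rewrite ffunE mulrC divfK.
  by apply/eqP; rewrite Li mul0r eq_sym eq_le l0 andbT -Li.
have LP (c : 'cV[R]_n) : \sum_i L i * (pol_mx m *m c) i 0 = \sum_j L j * c j 0.
  transitivity (\sum_i \sum_j (\sum_a lam i a * q a j) * c j 0).
    apply: eq_bigr => i _; rewrite pol_mxE mulr_sumr.
    under eq_bigr do rewrite mulrA LmE mulr_sumr.
    rewrite exchange_big/=; apply: eq_bigr => j _; rewrite mulr_suml.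
    by apply: eq_bigr => a _; rewrite mulrA.
  rewrite exchange_big/=; apply: eq_bigr => j _; rewrite -mulr_suml.
  by rewrite balance.
have Lr : \sum_i L i * pol_cost m i 0 <= 0.
  have -> : \sum_i L i * pol_cost m i 0 = - l None.
    rewrite -cost_le0; apply: eq_bigr => i _; rewrite mxE mulr_sumr.
    by apply: eq_bigr => a _; rewrite mulrA LmE.
  by rewrite oppr_le0.
pose c t := cum_cost (pol_mx m) (pol_cost m) t.
have cS t i : c t.+1 i 0 = pol_cost m i 0 + (pol_mx m *m c t) i 0.
  by rewrite /c /cum_cost iterS -/(cum_cost _ _ _) [LHS]mxE.
have Lc t : \sum_i L i * c t i 0 <= 0.
  elim: t => [|t IHt].
    by rewrite big1// => i _; rewrite /c /= mxE mulr0.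
  under eq_bigr do rewrite cS mulrDr.
  by rewrite big_split/= LP -[leRHS]addr0 lerD.
exfalso; apply: (prolm m i0 mP) => [t|].
  pose nt := survival (pol_mx m) t.
  have nt1 i : nt i 0 <= 1.
    apply: le_trans (ler_norm _) _; apply: iter_substoch_bound => //.
    - exact: pol_mx_ge0.
    - exact: pol_mx_le1.
    - by move=> j; rewrite mxE normr1.
  (* By invariance the [L]-average of the survival probabilities keeps its initial value. As they
     are at most 1, they equal 1 wherever [L] is positive. *)
  have Lnt : \sum_i L i * nt i 0 = \sum_i L i.
    rewrite /nt; elim: t {nt nt1} => [|t IHt]; last by rewrite /survival iterS LP.
    by apply: eq_bigr => i _; rewrite mxE mulr1.
  have : \sum_i L i * (1 - nt i 0) == 0.
    under eq_bigr do rewrite mulrBr mulr1.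
    by rewrite sumrB Lnt subrr.
  rewrite psumr_eq0 => [/allP/(_ i0 (mem_index_enum _))|i _]; last first.
    by rewrite mulr_ge0// subr_ge0.
  by rewrite implyTb mulf_eq0 gt_eqF//= subr_eq0 => /eqP.
have [M lowM] := lowm m mP.
have M0 : 0 <= M by have := lowM 0%N i0; rewrite /= mxE oppr_le0.
pose SL := \sum_i L i.
have SL0 : 0 <= SL by rewrite sumr_ge0.
(* The [L]-average of [c t] is nonpositive and every entry is at least [- M], so
   [L i * c t i 0 <= M * SL]. States with [L i = 0] add 0 to [B], the value of a division by
   zero. *)
pose B := \sum_i M * SL / L i.
have cB t i : 0 < L i -> c t i 0 <= B.
  move=> Li; apply: (@le_trans _ _ (M * SL / L i)); last first.
    rewrite /B (bigD1 i)//= lerDl sumr_ge0// => j _.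
    by rewrite divr_ge0// mulr_ge0.
  rewrite ler_pdivlMr// mulrC -subr_le0 (le_trans _ (Lc t))//.
  rewrite (bigD1 i)//= lerD2l /SL mulr_sumr -sumrN (bigD1 i)//=.
  rewrite -[leRHS]add0r lerD//; first by rewrite oppr_le0 mulr_ge0.
  apply: ler_sum => j _; rewrite mulrC -mulrN ler_wpM2l//; exact: lowM.
have [w wP] := proper_weight (pol_mx_ge0 m0P) m0N.
have [G G0 rG] := col_bound (pol_cost m).
have B0 : 0 <= B by apply: sumr_ge0 => j _; rewrite divr_ge0// mulr_ge0.
pose K := B + G.
have K0 : 0 <= K by rewrite addr_ge0.
(* Off the support the row of [m] is that of [m0], and the decrease of [K * w] by at least [K] pays
   for one stage cost, at most [G <= K]. *)
have cw t i : c t i 0 <= K * w i 0.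
  have Kw j : K <= K * w j 0 by rewrite ler_peMr//; have [] := wP j.
  elim: t i => [|t IHt] i; first by rewrite /c /= mxE (le_trans K0).
  have [Li|Li] := ltP 0 (L i).
    by rewrite (le_trans (cB _ _ Li))// (le_trans _ (Kw i))// lerDl.
  have Lz : L i = 0 by apply/eqP; rewrite eq_le Li L0.
  have Prow : (pol_mx m *m (K *: w)) i 0 <= K * (w i 0 - 1).
    have -> : (pol_mx m *m (K *: w)) i 0 = K * (pol_mx m0 *m w) i 0.
      rewrite -scalemxAr [LHS]mxE; congr (_ * _).
      by rewrite !pol_mxE /m Lz eqxx.
    by rewrite ler_wpM2l//; have [] := wP i.
  have : (pol_mx m *m c t) i 0 <= (pol_mx m *m (K *: w)) i 0.
    apply: mono_mulmx => [|j]; first exact: pol_mx_ge0.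
    by rewrite [leRHS]mxE.
  have : pol_cost m i 0 <= K.
    by rewrite (le_trans (ler_norm _))// (le_trans (rG i))// lerDr.
  rewrite cS; move: Prow; lra.
exists (\sum_i K * w i 0) => t j; apply: (le_trans (cw t j)).
rewrite (bigD1 j)//= lerDl sumr_ge0// => i _.
by rewrite mulr_ge0//; have [w1 _] := wP i; rewrite (le_trans _ w1).
Qed.

End DecisionProcess.

(** * The game as a decision process of either player *)

Section Game.
Variables (R : realType) (n : nat) (U V : 'I_n -> finType).
Variables (p g : forall i : 'I_n, U i -> V i -> option 'I_n -> R).
Hypothesis Hp : transition_kernel p.

Implicit Types (mu : forall i, {ffun U i -> R}) (nu : forall i, {ffun V i -> R}).

(** With the opponent fixed, moves to termination are dropped from the matrix, which becomes
    substochastic, while their costs are kept. *)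
Definition mdp1_trans nu i (u : U i) (j : 'I_n) := \sum_v nu i v * p u v (Some j).
Definition mdp1_cost nu i (u : U i) := \sum_v nu i v * \sum_j p u v j * g u v j.
Definition mdp2_trans mu i (v : V i) (j : 'I_n) := \sum_u mu i u * p u v (Some j).
Definition mdp2_cost mu i (v : V i) := \sum_u mu i u * \sum_j p u v j * g u v j.

Definition pair_mx mu nu := pol_mx (mdp1_trans nu) mu.
Definition pair_cost mu nu := pol_cost (mdp1_cost nu) mu.

Lemma pair_mx2E mu nu : pol_mx (mdp2_trans mu) nu = pair_mx mu nu.
Proof.
apply/matrixP => i j; rewrite !mxE.
under eq_bigr do rewrite mulr_sumr.
rewrite exchange_big/=; apply: eq_bigr => u _; rewrite mulr_sumr.
by apply: eq_bigr => v _; rewrite mulrCA.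
Qed.

Lemma pair_cost2E mu nu : pol_cost (mdp2_cost mu) nu = pair_cost mu nu.
Proof.
apply/matrixP => i j; rewrite !mxE.
under eq_bigr do rewrite mulr_sumr.
rewrite exchange_big/=; apply: eq_bigr => u _; rewrite mulr_sumr.
by apply: eq_bigr => v _; rewrite mulrCA.
Qed.

Lemma kernel_sum_Some_le1 i (u : U i) (v : V i) : \sum_j p u v (Some j) <= 1.
Proof. by have [p0 <-] := Hp u v; rewrite big_option lerDr. Qed.

Lemma kernel_ge0 i (u : U i) (v : V i) j : 0 <= p u v j.
Proof. by have [] := Hp u v. Qed.

Lemma average_ge0 (X : finType) (w : {ffun X -> R}) (f : X -> R) : isDist w ->
  (forall x, 0 <= f x) -> 0 <= \sum_x w x * f x.
Proof. by move=> [w0 _] f0; rewrite sumr_ge0// => x _; rewrite mulr_ge0. Qed.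

Lemma average_le (X : finType) (w : {ffun X -> R}) (f : X -> R) M : isDist w ->
  (forall x, f x <= M) -> \sum_x w x * f x <= M.
Proof.
move=> [w0 w1] fM; rewrite -[M]mul1r -w1 mulr_suml ler_sum// => x _.
by rewrite ler_wpM2l.
Qed.

Lemma mdp1_trans_ge0 nu : SRpolicy2 nu -> forall i (u : U i) j, 0 <= mdp1_trans nu u j.
Proof. by move=> nuP i u j; apply: average_ge0 => // v; exact: kernel_ge0. Qed.

Lemma mdp2_trans_ge0 mu : SRpolicy1 mu -> forall i (v : V i) j, 0 <= mdp2_trans mu v j.
Proof. by move=> muP i v j; apply: average_ge0 => // u; exact: kernel_ge0. Qed.

Lemma mdp1_trans_le1 nu : SRpolicy2 nu ->
  forall i (u : U i), \sum_j mdp1_trans nu u j <= 1.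
Proof.
move=> nuP i u; rewrite exchange_big/=; under eq_bigr do rewrite -mulr_sumr.
by apply: average_le => // v; exact: kernel_sum_Some_le1.
Qed.

Lemma mdp2_trans_le1 mu : SRpolicy1 mu ->
  forall i (v : V i), \sum_j mdp2_trans mu v j <= 1.
Proof.
move=> muP i v; rewrite exchange_big/=; under eq_bigr do rewrite -mulr_sumr.
by apply: average_le => // u; exact: kernel_sum_Some_le1.
Qed.

Lemma pair_mx_ge0 mu nu : SRpolicy1 mu -> SRpolicy2 nu ->
  forall i j, 0 <= pair_mx mu nu i j.
Proof. by move=> muP nuP; apply: pol_mx_ge0 => //; exact: mdp1_trans_ge0. Qed.

Lemma pair_mx_le1 mu nu : SRpolicy1 mu -> SRpolicy2 nu ->
  forall i, \sum_j pair_mx mu nu i j <= 1.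
Proof. by move=> muP nuP; apply: pol_mx_le1 => //; exact: mdp1_trans_le1. Qed.

Lemma pair_mxE mu nu (c : 'cV[R]_n) i : (pair_mx mu nu *m c) i 0 =
  \sum_u \sum_v mu i u * nu i v * \sum_j p u v (Some j) * c j 0.
Proof.
rewrite pol_mxE; apply: eq_bigr => u _; under [RHS]eq_bigr do rewrite -mulrA.
rewrite -mulr_sumr; congr (_ * _).
under [RHS]eq_bigr do rewrite mulr_sumr.
rewrite exchange_big/=; apply: eq_bigr => j _; rewrite mulr_suml.
by apply: eq_bigr => v _; rewrite mulrA.
Qed.

Lemma not_termE mu nu t i : not_term p mu nu t i = survival (pair_mx mu nu) t i 0.
Proof.
elim: t i => [|t IHt] i; first by rewrite /survival/= mxE.
rewrite /survival iterS -/(survival _ t) pair_mxE /=.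
apply: eq_bigr => u _; apply: eq_bigr => v _; congr (_ * _).
by apply: eq_bigr => j _; rewrite IHt.
Qed.

(** [exp_cost t] adds the stages 0 to [t], whereas [cum_cost] starts from the empty sum; hence the
    index [t.+1]. *)
Lemma exp_costE mu nu t i : exp_cost p g mu nu t i =
  cum_cost (pair_mx mu nu) (pair_cost mu nu) t.+1 i 0.
Proof.
have gE : pair_cost mu nu i 0 =
    \sum_u \sum_v mu i u * nu i v * \sum_j p u v j * g u v j.
  rewrite mxE; apply: eq_bigr => u _; under [RHS]eq_bigr do rewrite -mulrA.
  by rewrite -mulr_sumr.
have addE (a b : 'cV[R]_n) : (a + b) i 0 = a i 0 + b i 0 by rewrite mxE.
elim: t i gE addE => [|t IHt] i gE addE.
  rewrite /cum_cost/= mulmx0 addr0 gE.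
  apply: eq_bigr => u _; apply: eq_bigr => v _; congr (_ * _).
  by apply: eq_bigr => j _; rewrite addr0.
rewrite /cum_cost iterS -/(cum_cost _ _ t.+1) addE gE pair_mxE /=.
rewrite -big_split; apply: eq_bigr => u _; rewrite -big_split; apply: eq_bigr => v _ /=.
rewrite -mulrDr; congr (_ * _); under eq_bigr do rewrite mulrDr.
rewrite big_split; congr (_ + _); rewrite big_option mulr0 add0r /=.
apply: eq_bigr => j _; congr (_ * _); apply: IHt; last by move=> a b; rewrite mxE.
rewrite mxE; apply: eq_bigr => u' _; under [RHS]eq_bigr do rewrite -mulrA.
by rewrite -mulr_sumr.
Qed.


Lemma Jcost_sandwich mu nu i M :
  (forall t, `|cum_cost (pair_mx mu nu) (pair_cost mu nu) t i 0| <= M) ->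
  Jcost p g mu nu i <> +oo%E /\ Jcost p g mu nu i <> -oo%E.
Proof.
move=> cM; have uM t : (- M <= exp_cost p g mu nu t i <= M).
  by rewrite -ler_norml exp_costE.
have JM : (Jcost p g mu nu i <= M%:E)%E.
  rewrite /Jcost limn_einf_lim; apply: lime_le; first exact: is_cvg_einfs.
  apply: nearW => t; apply: ereal_inf_le; exists (exp_cost p g mu nu t i)%:E => /=.
    by exists t => /=.
  by rewrite lee_fin; have /andP[] := uM t.
have MJ : ((- M)%:E <= Jcost p g mu nu i)%E.
  rewrite /Jcost limn_einf_lim; apply: lime_ge; first exact: is_cvg_einfs.
  apply: nearW => t; apply: le_ereal_inf_tmp => _ [k /= _ <-].
  by rewrite lee_fin; have /andP[] := uM k.
by split=> J; move: JM MJ; rewrite J.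
Qed.

Lemma pinfty_of_linear_growth (u : nat -> R) a B : 0 < a ->
  (forall t, t%:R * a - B <= u t) -> (fun t => (u t)%:E) @ \oo --> +oo%E.
Proof.
move=> a0 uB; apply/cvgeryP/cvgryPge => C.
exists (Num.truncn ((C + B) / a)).+1 => // t /= tC.
apply: le_trans (uB t); rewrite lerBrDr -ler_pdivrMr//.
by rewrite ltW// (lt_le_trans (truncnS_gt _))// ler_nat.
Qed.

Lemma ninfty_of_linear_growth (u : nat -> R) a B : a < 0 ->
  (forall t, u t <= t%:R * a + B) -> (fun t => (u t)%:E) @ \oo --> -oo%E.
Proof.
move=> a0 uB; apply/cvgerNyP/cvgrNyPle => C.
exists (Num.truncn ((B - C) / - a)).+1 => // t /= tC.
apply: (le_trans (uB t)); rewrite -lerBrDr -lerN2 -mulrN opprB -ler_pdivrMr ?oppr_gt0//.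
by rewrite ltW// (lt_le_trans (truncnS_gt _))// ler_nat.
Qed.

(** With a positive gain [a i 0] the costs, and so their liminf, would be [+oo] in the limit. A
    nonpositive gain leaves them below [B] at all times. *)
Lemma cum_cost_ub mu nu i : SRpolicy1 mu -> SRpolicy2 nu ->
  (Jcost p g mu nu i < +oo)%E ->
  exists M, forall t, cum_cost (pair_mx mu nu) (pair_cost mu nu) t i 0 <= M.
Proof.
move=> muP nuP; have [a [B aB]] :=
  cum_cost_linear_growth (pair_mx_ge0 muP nuP) (pair_mx_le1 muP nuP) (pair_cost mu nu).
have [a0|a0] := leP (a i 0) 0 => Joo.
  exists B => t; have := aB t i; rewrite ler_norml => /andP[_].
  rewrite lerBlDr => /le_trans; apply; rewrite gerDl; exact: mulr_ge0_le0.
exfalso; move: Joo; rewrite /Jcost is_cvg_limn_einfE.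
  have : (fun t => (exp_cost p g mu nu t i)%:E) @ \oo --> +oo%E.
    apply: (@pinfty_of_linear_growth _ (a i 0) B) => // t.
    have := aB t.+1 i; rewrite ler_norml -exp_costE => /andP[].
    by rewrite -natr1 mulrDl mul1r; lra.
  by move/cvg_lim => ->.
apply/cvg_ex; exists +oo%E; apply: (@pinfty_of_linear_growth _ (a i 0) B) => // t.
have := aB t.+1 i; rewrite ler_norml -exp_costE => /andP[].
by rewrite -natr1 mulrDl mul1r; lra.
Qed.

Lemma cum_cost_lb mu nu i : SRpolicy1 mu -> SRpolicy2 nu ->
  (-oo < Jcost p g mu nu i)%E ->
  exists M, forall t, - M <= cum_cost (pair_mx mu nu) (pair_cost mu nu) t i 0.
Proof.
move=> muP nuP; have [a [B aB]] :=
  cum_cost_linear_growth (pair_mx_ge0 muP nuP) (pair_mx_le1 muP nuP) (pair_cost mu nu).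
have [a0|a0] := leP 0 (a i 0) => Joo.
  exists B => t; have := aB t i; rewrite ler_norml => /andP[+ _].
  by have : 0 <= t%:R * a i 0 by [exact: mulr_ge0]; lra.
exfalso; move: Joo; rewrite /Jcost.
have uNy : (fun t => (exp_cost p g mu nu t i)%:E) @ \oo --> -oo%E.
  apply: (@ninfty_of_linear_growth _ (a i 0) B) => // t.
  have := aB t.+1 i; rewrite ler_norml -exp_costE => /andP[].
  by rewrite -natr1 mulrDl mul1r; lra.
rewrite is_cvg_limn_einfE; last by apply/cvg_ex; exists -oo%E.
by move/cvg_lim : uNy => ->.
Qed.

Lemma uniform_col_bound (Pr : R -> 'I_n -> Prop) :
  (forall x y i, x <= y -> Pr x i -> Pr y i) ->
  (forall i, exists M, Pr M i) -> exists M, forall i, Pr M i.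
Proof.
move=> mono /choice[M MP]; exists (\sum_i `|M i|) => i.
apply: mono (MP i); rewrite (bigD1 i)//= (le_trans (ler_norm _))// lerDl.
exact: sumr_ge0.
Qed.

Hypothesis Hssp : SSP_assumption p g.

Lemma prolonging_of_survival mu nu i :
  (forall t, survival (pair_mx mu nu) t i 0 = 1) -> prolonging p mu nu.
Proof.
move=> s1; exists i; 
have -> : range (fun t => not_term p mu nu t i) = [set 1]; last by rewrite inf1.
apply/seteqP; split => [_ [t _ <-]|_ ->]; first by rewrite /= not_termE.
by exists 0%N.
Qed.

(** Without prolongation every state has survival below 1/2 at some time. Survival decreases in
    time, so the largest of these times serves all states. *)
Lemma survival_half mu nu : SRpolicy1 mu -> SRpolicy2 nu -> ~ prolonging p mu nu ->
  exists N, forall i, survival (pair_mx mu nu) N i 0 <= 1 / 2.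
Proof.
move=> muP nuP nprol.
have P0 := pair_mx_ge0 muP nuP; have P1 := pair_mx_le1 muP nuP.
have halfi i : exists t, survival (pair_mx mu nu) t i 0 < 1 / 2.
  have [||y [t _ <-] yt] := @inf_lt _ (range (fun t => not_term p mu nu t i)) (1 / 2).
  - by exists 1; exists 0%N.
  - have [//|nt0] := leP (inf (range (fun t => not_term p mu nu t i))) 0.
      by move=> /le_lt_trans; apply; lra.
    by exfalso; apply: nprol; exists i.
  - by exists t; rewrite -not_termE.
have decr t : forall i, survival (pair_mx mu nu) t.+1 i 0 <= survival (pair_mx mu nu) t i 0.
  elim: t => [|t IHt] i.
    rewrite /survival/= [leRHS]mxE (le_trans (ler_norm _))//.
    by apply: mulmx_substoch_bound => // j; rewrite mxE normr1.
  exact: (@mono_mulmx _ _ _ (survival _ t.+1) (survival _ t)).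
have {decr}decr s t i : (s <= t)%N ->
    survival (pair_mx mu nu) t i 0 <= survival (pair_mx mu nu) s i 0.
  elim: t => [|t IHt]; first by rewrite leqn0 => /eqP->.
  rewrite leq_eqVlt => /orP[/eqP->//|]; rewrite ltnS => /IHt.
  exact: le_trans (decr _ _).
have [t tP] := choice halfi.
exists (\max_i t i) => i; apply: le_trans (ltW (tP i)).
by apply: decr; exact: leq_bigmax.
Qed.

(** Against the policy of condition (ii) costs are bounded below for every [mu]; a prolonging pair
    with costs bounded above as well would contradict (iii). *)
Lemma player1_subsolution : exists nu (h : 'I_n -> R) e,
  [/\ SRpolicy2 nu, 0 < e & forall i (u : U i), h i + e <=
    \sum_v nu i v * \sum_j p u v j * (g u v j + oapp h 0 j)].
Proof.
have [[mub [mubP Hmub]] [[nub [nubP Hnub]] prolP]] := Hssp.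
(* The pair has a value below [+oo] by (i) and above [-oo] by (ii) at every state, which (iii)
   excludes for prolonging pairs. *)
have nprol : ~ prolonging p mub nub.
  move=> /(prolP _ _ mubP nubP)[i [J|J]].
    by have := Hmub nub nubP i; rewrite J.
  by have := Hnub mub mubP i; rewrite J.
have lowm mu : SRpolicy1 mu -> exists M, forall t i,
    - M <= cum_cost (pair_mx mu nub) (pair_cost mu nub) t i 0.
  move=> muP; have [|i|M MP] := @uniform_col_bound
    (fun M i => forall t, - M <= cum_cost (pair_mx mu nub) (pair_cost mu nub) t i 0).
  - by move=> x y i xy xP t; rewrite (le_trans _ (xP t))// lerN2.
  - by apply: cum_cost_lb => //; exact: Hnub.
  - by exists M.
have [|//||h [e [e0 hP]]] := mdp_strict_subsolution
  (mdp1_trans_ge0 nubP) (mdp1_trans_le1 nubP) (r := mdp1_cost nub).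
- by exists mub; split => //; exact: survival_half.
- move=> mu i muP s1 [M cM].
  have [k [J|J]] := prolP mu nub muP nubP (prolonging_of_survival s1).
    have [M' cM'] := lowm mu muP.
    have [|+ _] := @Jcost_sandwich mu nub k (Num.max M M'); last exact.
    move=> t; rewrite ler_norml lerNl !le_max (cM t k)/= andbT.
    by rewrite [X in _ || X]lerNl (cM' t k) orbT.
  by have := Hnub mu muP k; rewrite J.
exists nub, h, e; split => // i u; apply: (le_trans (hP i u)).
(* The sides are equal: [h], extended by 0, contributes nothing at termination. *)
rewrite le_eqVlt; apply/orP; left; apply/eqP.
under [RHS]eq_bigr => v _ do under eq_bigr => j _ do rewrite mulrDr.
under [RHS]eq_bigr => v _ do rewrite big_split/= mulrDr.
rewrite big_split/=; congr (_ + _).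
under eq_bigr do rewrite mulr_suml.
rewrite exchange_big/=; apply: eq_bigr => v _.
rewrite big_option mulr0 add0r mulr_sumr.
by apply: eq_bigr => j _; rewrite mulrA.
Qed.

(** Negating the costs turns the upper bounds from condition (i), valid against every [nu], into the
    lower bounds that the decision process asks for. *)
Lemma player2_subsolution : exists mu (h : 'I_n -> R) e,
  [/\ SRpolicy1 mu, 0 < e & forall i (v : V i), h i + e <=
    \sum_u mu i u * \sum_j p u v j * (- g u v j + oapp h 0 j)].
Proof.
have [[mub [mubP Hmub]] [[nub [nubP Hnub]] prolP]] := Hssp.
have nprol : ~ prolonging p mub nub.
  move=> /(prolP _ _ mubP nubP)[i [J|J]].
    by have := Hmub nub nubP i; rewrite J.
  by have := Hnub mub mubP i; rewrite J.
have upm nu : SRpolicy2 nu -> exists M, forall t i,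
    cum_cost (pair_mx mub nu) (pair_cost mub nu) t i 0 <= M.
  move=> nuP; have [|i|M MP] := @uniform_col_bound
    (fun M i => forall t, cum_cost (pair_mx mub nu) (pair_cost mub nu) t i 0 <= M).
  - by move=> x y i xy xP t; rewrite (le_trans (xP t)).
  - by apply: cum_cost_ub => //; exact: Hmub.
  - by exists M.
have negE nu t i :
    cum_cost (pol_mx (mdp2_trans mub) nu) (pol_cost (fun i v => - mdp2_cost mub v) nu) t i 0
    = - cum_cost (pair_mx mub nu) (pair_cost mub nu) t i 0.
  have -> : pol_cost (fun i v => - mdp2_cost mub v) nu = - pair_cost mub nu.
    rewrite -pair_cost2E; apply/colP => k; rewrite !mxE -sumrN.
    by apply: eq_bigr => v _; rewrite mulrN.
  rewrite pair_mx2E; have -> : cum_cost (pair_mx mub nu) (- pair_cost mub nu) t =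
      - cum_cost (pair_mx mub nu) (pair_cost mub nu) t.
    elim: t => [|t IHt]; first by rewrite /cum_cost/= oppr0.
    by rewrite /cum_cost iterS -/(cum_cost _ _ t) IHt mulmxN -opprD.
  by rewrite mxE.
have [||| h [e [e0 hP]]] := mdp_strict_subsolution
  (mdp2_trans_ge0 mubP) (mdp2_trans_le1 mubP) (r := fun i v => - mdp2_cost mub v).
- by exists nub; split => //; rewrite pair_mx2E; exact: survival_half.
- move=> nu nuP; have [M MP] := upm nu nuP; exists M => t i.
  by rewrite negE lerN2.
- move=> nu i nuP; rewrite pair_mx2E => s1 [M cM].
  have [k [J|J]] := prolP mub nu mubP nuP (prolonging_of_survival s1).
    by have := Hmub nu nuP k; rewrite J.
  have [M' cM'] := upm nu nuP.
  have [|_ +] := @Jcost_sandwich mub nu k (Num.max M M'); last exact.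
  move=> t; rewrite ler_norml lerNl !le_max (cM' t k) orbT andbT.
  by have := cM t k; rewrite -pair_mx2E negE pair_mx2E => ->.
exists mub, h, e; split => // i v; apply: (le_trans (hP i v)).
rewrite le_eqVlt; apply/orP; left; apply/eqP.
under [RHS]eq_bigr => u _ do under eq_bigr => j _ do rewrite mulrDr.
under [RHS]eq_bigr => u _ do rewrite big_split/= mulrDr.
rewrite big_split/=; congr (_ + _).
  rewrite -sumrN; apply: eq_bigr => u _; rewrite -mulrN -sumrN; congr (_ * _).
  by apply: eq_bigr => j _; rewrite mulrN.
under eq_bigr do rewrite mulr_suml.
rewrite exchange_big/=; apply: eq_bigr => u _.
rewrite big_option mulr0 add0r mulr_sumr.
by apply: eq_bigr => j _; rewrite mulrA.
Qed.

End Game.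

(** * Stochastic approximation *)

Lemma indic_fiberE (R : pzRingType) (T : Type) (J : eqType) (j : T -> J) k w :
  \1_[set w | j w = k] w = (j w == k)%:R :> R.
Proof.
rewrite indicE; case: eqP => [jk|jk]; first by rewrite mem_set.
by rewrite memNset.
Qed.

(** * Integrals of bounded functions measurable for a sub-sigma-algebra *)

Section SubSigmaAlgebra.
Context d (T : measurableType d) (R : realType) (P : probability T R).
Implicit Types (G H : set (set T)) (X Y : T -> R).

Definition bounded_measurable G X :=
  measurable_fun setT (X : g_sigma_algebraType G -> R) /\ exists M, forall w, `|X w| <= M.

Lemma measurable_wrt_RP G X : sigma_algebra setT G ->
  measurable_wrt_R G X <-> measurable_fun setT (X : g_sigma_algebraType G -> R).
Proof.
move=> Gs; split=> [mX _ B mB|mX B mB].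
  by rewrite setTI; apply: sub_sigma_algebra; exact: mX.
have := mX measurableT B mB; rewrite setTI.
by rewrite /measurable/= sigma_algebra_id.
Qed.

Lemma bounded_measurable_sub G H X : G `<=` H ->
  bounded_measurable G X -> bounded_measurable H X.
Proof.
move=> GH [mX bX]; split => // _ B mB.
have := mX measurableT B mB; rewrite /measurable/=.
exact: sub_smallest2r.
Qed.

Lemma bounded_measurableD G X Y : bounded_measurable G X -> bounded_measurable G Y ->
  bounded_measurable G (fun w => X w + Y w).
Proof.
move=> [mX [M XM]] [mY [N YN]]; split; first exact: measurable_funD.
by exists (M + N) => w; rewrite (le_trans (ler_normD _ _))// lerD.
Qed.

Lemma bounded_measurableM G X Y : bounded_measurable G X -> bounded_measurable G Y ->
  bounded_measurable G (fun w => X w * Y w).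
Proof.
move=> [mX [M XM]] [mY [N YN]]; split; first exact: measurable_funM.
by exists (M * N) => w; rewrite normrM ler_pM.
Qed.

Lemma bounded_measurable_cst G c : bounded_measurable G (fun=> c).
Proof. by split; [exact: measurable_cst|exists `|c|]. Qed.

Lemma bounded_measurable_indic G D : G D -> bounded_measurable G (\1_D).
Proof.
move=> GD; split.
  by apply: measurable_indic; exact: sub_sigma_algebra.
by exists 1 => w; rewrite indicE; case: (_ \in _); rewrite ?normr1 ?normr0.
Qed.

Lemma bounded_measurable_integrable G X : sigma_algebra setT G -> G `<=` measurable ->
  bounded_measurable G X -> P.-integrable setT (EFin \o X).
Proof.
move=> Gs Gm [mX [M XM]]; apply: measurable_bounded_integrable => //.
- by rewrite (le_lt_trans (probability_le1 P _))// ltry.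
- move=> _ B mB; rewrite setTI; apply: Gm.
  by apply: (measurable_wrt_RP X Gs).2.
- exists M; split; first exact: num_real.
  by move=> y My w _; exact: le_trans (XM w) (ltW My).
Qed.

(** The factorization concerns sets of [G] only. Pushed forward to [G] along the identity, the
    restriction of [P] to [D] is [c] times [P], and [X] can be integrated there. *)
Lemma ge0_integral_indic_indep G X D (c : R) : sigma_algebra setT G -> G `<=` measurable ->
  measurable_fun setT (X : g_sigma_algebraType G -> R) -> (forall w, 0 <= X w) ->
  measurable D -> 0 <= c -> (forall A, G A -> P (A `&` D) = (c%:E * P A)%E) ->
  (\int[P]_w (X w * \1_D w)%:E = c%:E * \int[P]_w (X w)%:E)%E.
Proof.
move=> Gs Gm mX X0 mD c0 GD.
pose phi : T -> g_sigma_algebraType G := id.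
have mphi : measurable_fun setT phi.
  move=> _ B; rewrite /measurable/= sigma_algebra_id// => GB.
  by rewrite setTI; exact: Gm.
have mXT : measurable_fun [set: T] X.
  move=> _ B mB; rewrite setTI; apply: Gm.
  by apply: (measurable_wrt_RP X Gs).2.
have mX' : measurable_fun [set: g_sigma_algebraType G] (EFin \o X).
  exact/measurable_EFinP.
pose m := mrestr P mD.
transitivity (\int[m]_w (X w)%:E)%E.
  have -> : (\int[m]_w (X w)%:E = \int[m]_(w in D `|` ~` D) (X w)%:E)%E by rewrite setUv.
  rewrite ge0_integral_setU//=; last 4 first.
  - exact: measurableC.
  - by rewrite setUv; apply/measurable_EFinP.
  - by move=> w _; rewrite lee_fin.
  - by rewrite disj_set2E setICr.
  rewrite [X in (_ + X)%E]null_set_integral ?adde0; last 3 first.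
  - exact: measurableC.
  - apply: (@measurable_funS _ _ _ _ setT) => //; exact/measurable_EFinP.
  - by transitivity (P (~` D `&` D)); [by []|rewrite setICl measure0].
  rewrite [RHS](eq_measure_integral P); last first.
    by move=> A mA AD; transitivity (P (A `&` D)); [by []|rewrite setIidl].
  rewrite [RHS]integral_mkcond; apply: eq_integral => w _.
  rewrite /patch indicE; case: ifPn; rewrite ?mulr1//.
  by rewrite mulr0.
transitivity (\int[pushforward m phi]_w (X w)%:E)%E.
  by rewrite (ge0_integral_pushforward mphi)// => w _; rewrite lee_fin.
rewrite (eq_measure_integral (mscale (NngNum c0) (pushforward P phi))).
  rewrite ge0_integral_mscale//=; last by move=> w _; rewrite lee_fin.
  by rewrite (ge0_integral_pushforward mphi)// => w _; rewrite lee_fin.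
move=> A mA _; rewrite /= /mscale/= /pushforward /m /mrestr GD//.
by move: mA; rewrite /measurable/= sigma_algebra_id.
Qed.

Lemma Rintegral_indic_indep G X D (c : R) : sigma_algebra setT G -> G `<=` measurable ->
  bounded_measurable G X -> measurable D -> 0 <= c ->
  (forall A, G A -> P (A `&` D) = (c%:E * P A)%E) ->
  \int[P]_w (X w * \1_D w) = c * \int[P]_w X w.
Proof.
move=> Gs Gm mX mD c0 GD.
have Ms : sigma_algebra setT (@measurable _ T) by exact: sigma_algebra_measurable.
have int Y : bounded_measurable G Y -> P.-integrable setT (EFin \o Y).
  exact: bounded_measurable_integrable.
have intD Y : bounded_measurable G Y ->
    P.-integrable setT (EFin \o (fun w => Y w * \1_D w)).
  move=> mY; apply: (@bounded_measurable_integrable measurable) => //.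
  apply: bounded_measurableM; last exact: bounded_measurable_indic.
  exact: bounded_measurable_sub mY.
have pos Y : bounded_measurable G Y -> (forall w, 0 <= Y w) ->
    \int[P]_w (Y w * \1_D w) = c * \int[P]_w Y w.
  move=> mY Y0; have [mY' _] := mY.
  rewrite /Rintegral (@ge0_integral_indic_indep G _ _ c)// fineM//.
  exact: (integrable_fin_num _ (int _ mY)).
(* Adding the constant [M'] makes [X] nonnegative. *)
have [_ [M XM]] := mX; pose M' := `|M|.
have mM : bounded_measurable G (fun=> M') by exact: bounded_measurable_cst.
have mY := bounded_measurableD mX mM.
transitivity (\int[P]_w ((X w + M') * \1_D w - M' * \1_D w)).
  by apply: eq_Rintegral => w _; rewrite mulrDl addrK.
rewrite RintegralB//; [|exact: (intD _ mY)|exact: (intD _ mM)].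
rewrite (pos _ mY) => [|w]; last first.
  by have := XM w; rewrite ler_norml => /andP[+ _]; have := ler_norm M; rewrite -/M'; lra.
rewrite (pos _ mM) => [|w]; last exact: normr_ge0.
by rewrite -mulrBr -RintegralB//; [congr (_ * _); apply: eq_Rintegral => w _; rewrite addrK|exact: int..].
Qed.

Lemma Rintegral_sum G (I : Type) (s : seq I) (f : I -> T -> R) :
  sigma_algebra setT G -> G `<=` measurable -> (forall i, bounded_measurable G (f i)) ->
  bounded_measurable G (fun w => \sum_(i <- s) f i w) /\
  \int[P]_w (\sum_(i <- s) f i w) = \sum_(i <- s) \int[P]_w f i w.
Proof.
move=> Gs Gm mf; elim: s => [|i s [IHm IHs]].
  split.
    rewrite [X in bounded_measurable _ X](_ : _ = fun=> 0).
      exact: bounded_measurable_cst.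
    by apply/funext => w; rewrite big_nil.
  by under eq_Rintegral do rewrite big_nil; rewrite Rintegral_cst// mul0r big_nil.
split.
  rewrite [X in bounded_measurable _ X](_ : _ = fun w => f i w + \sum_(i <- s) f i w).
    exact: bounded_measurableD.
  by apply/funext => w; rewrite big_cons.
under eq_Rintegral do rewrite big_cons.
by rewrite RintegralD//; [rewrite IHs big_cons|exact: (@bounded_measurable_integrable G)..].
Qed.

(** Splitting along the fibres of [j] reduces the claim to indicators. Testing against all bounded
    [X] measurable for [G] stands for a vanishing conditional expectation. *)
Lemma Rintegral_centered_noise G (J : finType) (j : T -> J) (q phi : J -> R) X :
  sigma_algebra setT G -> G `<=` measurable -> bounded_measurable G X ->
  (forall k, measurable [set w | j w = k]) -> (forall k, 0 <= q k) ->
  (forall k A, G A -> P (A `&` [set w | j w = k]) = ((q k)%:E * P A)%E) ->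
  \int[P]_w (X w * (phi (j w) - \sum_k q k * phi k)) = 0.
Proof.
move=> Gs Gm mX mj q0 jq.
have Ms : sigma_algebra setT (@measurable _ T) by exact: sigma_algebra_measurable.
have mX' : bounded_measurable measurable X by exact: bounded_measurable_sub mX.
pose f k w := phi k * (X w * \1_[set w | j w = k] w).
have mf0 k : bounded_measurable measurable (fun w => X w * \1_[set w | j w = k] w).
  by apply: bounded_measurableM => //; exact: bounded_measurable_indic.
have mf k : bounded_measurable measurable (f k).
  by apply: bounded_measurableM => //; exact: bounded_measurable_cst.
have [msum sumE] := Rintegral_sum (index_enum J) Ms (@subset_refl _ _) mf.
pose m := \sum_k q k * phi k.
transitivity (\int[P]_w (\sum_k f k w - m * X w)).
  apply: eq_Rintegral => w _.
  have -> : \sum_k f k w = phi (j w) * X w.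
    rewrite (bigD1 (j w))// big1 ?addr0 => [|k kj]; rewrite /f indic_fiberE.
      by rewrite eqxx mulr1; exact: addr0.
    by rewrite eq_sym (negPf kj) !mulr0.
  by rewrite -/m; ring.
have imX : P.-integrable setT (EFin \o (fun w => m * X w)).
  apply: (@bounded_measurable_integrable measurable) => //.
  by apply: bounded_measurableM => //; exact: bounded_measurable_cst.
rewrite RintegralB//; last exact: (@bounded_measurable_integrable measurable).
rewrite sumE RintegralZl//; last exact: (@bounded_measurable_integrable measurable).
rewrite /m mulr_suml -sumrB big1// => k _.
rewrite RintegralZl//; last exact: (@bounded_measurable_integrable measurable).
by rewrite (@Rintegral_indic_indep G _ _ (q k))//; [ring|exact: jq].
Qed.

End SubSigmaAlgebra.

(** * Tails of weighted noise sums *)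

Section NoiseSums.
Context d (T : measurableType d) (R : realType) (P : probability T R).
Variables (F : nat -> set (set T)) (HF : filtration F).
Variables (c xi : nat -> T -> R) (B K e : R).
Hypothesis mc : forall t, bounded_measurable (F t) (c t).
Hypothesis mxi : forall t, bounded_measurable (F t.+1) (xi t).
Hypothesis xiB : forall t w, `|xi t w| <= B.
Hypothesis xi_mean0 : forall t X, bounded_measurable (F t) X ->
  \int[P]_w (X w * xi t w) = 0.
Hypothesis cK : forall t w, \sum_(r < t) c r w ^+ 2 <= K.
Hypothesis e_gt0 : 0 < e.

Let Fs t : sigma_algebra setT (F t). Proof. by have [+ _] := HF. Qed.
Let Fm t : F t `<=` measurable. Proof. by have [_ [+ _]] := HF. Qed.

Lemma filtration_sub s t : (s <= t)%N -> F s `<=` F t.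
Proof.
have [_ [_ FS]] := HF; elim: t => [|t IHt]; first by rewrite leqn0 => /eqP->.
rewrite leq_eqVlt => /orP[/eqP->//|]; rewrite ltnS => /IHt st.
exact: subset_trans (FS t).
Qed.

Let int t X : bounded_measurable (F t) X -> P.-integrable setT (EFin \o X).
Proof. exact: bounded_measurable_integrable. Qed.

(* Stopping at level [e] lets Chebyshev's inequality at time [k] control the whole
   path up to [k]. *)
Fixpoint stopped_sum s k w : R :=
  if k is k'.+1 then
    stopped_sum s k' w +
      \1_[set w | `|stopped_sum s k' w| < e] w * c (s + k') w * xi (s + k') w
  else 0.

Definition running s k : set T := [set w | `|stopped_sum s k w| < e].

Lemma F_running s k : bounded_measurable (F (s + k)) (stopped_sum s k) ->
  F (s + k) (running s k).
Proof.
move=> [mN _]; have -> : running s k = stopped_sum s k @^-1` `]- e, e[%classic.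
  by apply/seteqP; split => w; rewrite /running /= in_itv/= ltr_norml.
by apply: (measurable_wrt_RP _ (Fs _)).2 => //; exact: measurable_itv.
Qed.

Lemma stopped_sum_measurable s k : bounded_measurable (F (s + k)) (stopped_sum s k).
Proof.
elim: k => [|k IHk]; first exact: bounded_measurable_cst.
rewrite addnS; have FSk := @filtration_sub (s + k) (s + k).+1 (leqnSn _).
apply: bounded_measurableD; first exact: bounded_measurable_sub IHk.
apply: bounded_measurableM; last exact: mxi.
apply: bounded_measurableM; last exact: bounded_measurable_sub (mc _).
by apply: bounded_measurable_indic; apply: FSk; exact: F_running.
Qed.

Let v t := \int[P]_w (c t w ^+ 2).

Lemma bounded_measurable_sqr (G : set (set T)) (X : T -> R) : bounded_measurable G X ->
  bounded_measurable G (fun w => X w ^+ 2).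
Proof. by move=> mX; exact: (bounded_measurableM mX mX). Qed.

(** The cross term has integral zero, since the sum so far, the running indicator and the weight are
    known at time [s + k]. What remains is a square of at most [B ^+ 2 * c ^+ 2]. *)
Lemma stopped_sum_variance s k :
  \int[P]_w (stopped_sum s k w ^+ 2) <= B ^+ 2 * \sum_(r < k) v (s + r).
Proof.
elim: k => [|k IHk].
  rewrite big_ord0 mulr0; under eq_Rintegral do rewrite expr0n/=.
  by rewrite Rintegral_cst// mul0r.
pose N := stopped_sum s k; pose D w := \1_(running s k) w * c (s + k) w.
have mN : bounded_measurable (F (s + k)) N by exact: stopped_sum_measurable.
have mD : bounded_measurable (F (s + k)) D.
  apply: bounded_measurableM => //; apply: bounded_measurable_indic.
  exact: F_running.
have FSk := @filtration_sub (s + k) (s + k).+1 (leqnSn _).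
have mND : bounded_measurable (F (s + k)) (fun w => 2 * (N w * D w)).
  apply: bounded_measurableM; first exact: bounded_measurable_cst.
  exact: bounded_measurableM.
have mN2 := bounded_measurable_sqr mN.
have mNDx : bounded_measurable (F (s + k).+1) (fun w => 2 * (N w * D w) * xi (s + k) w).
  by apply: bounded_measurableM => //; exact: bounded_measurable_sub mND.
have mDx2 : bounded_measurable (F (s + k).+1) (fun w => (D w * xi (s + k) w) ^+ 2).
  apply: bounded_measurable_sqr; apply: bounded_measurableM => //.
  exact: bounded_measurable_sub mD.
have -> : \int[P]_w (stopped_sum s k.+1 w ^+ 2) = \int[P]_w (N w ^+ 2 +
    (2 * (N w * D w) * xi (s + k) w + (D w * xi (s + k) w) ^+ 2)).
  by apply: eq_Rintegral => w _; rewrite /= -/(running s k) -/(N w) -/(D w); ring.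
rewrite RintegralD//; [|exact: int mN2|exact: int (bounded_measurableD mNDx mDx2)].
rewrite RintegralD//; [|exact: int mNDx|exact: int mDx2].
rewrite xi_mean0// add0r big_ord_recr/= mulrDr lerD//.
have mc2 := bounded_measurable_sqr (mc (s + k)).
rewrite /v -RintegralZl//; last exact: int mc2.
apply: le_Rintegral => //.
- exact: int mDx2.
- apply: (@int (s + k)); apply: bounded_measurableM => //.
  exact: bounded_measurable_cst.
- move=> w _; rewrite exprMn mulrC ler_pM ?sqr_ge0//.
    rewrite -[leLHS]real_normK ?num_real// lerXn2r ?nnegrE//.
    by rewrite (le_trans (normr_ge0 _) (xiB (s + k) w)).
  rewrite /D exprMn indicE; case: (_ \in _); rewrite /= ?expr1n ?mul1r//.
  by rewrite expr0n/= mul0r sqr_ge0.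
Qed.

Definition reached s k : set T := [set w | e <= `|stopped_sum s k w|].

Lemma reachedC s k : reached s k = ~` running s k.
Proof. by apply/seteqP; split => w; rewrite /reached /running /= leNgt => /negP. Qed.

Lemma measurable_reached s k : measurable (reached s k).
Proof.
rewrite reachedC; apply: measurableC; apply: (Fm (t := s + k)).
by apply: F_running; exact: stopped_sum_measurable.
Qed.

Lemma reached_chebyshev s k :
  fine (P (reached s k)) <= B ^+ 2 / e ^+ 2 * \sum_(r < k) v (s + r).
Proof.
have mN2 := bounded_measurable_sqr (stopped_sum_measurable s k).
rewrite mulrAC ler_pdivlMr ?exprn_gt0//.
apply: le_trans (stopped_sum_variance s k).
have Ms : sigma_algebra setT (@measurable _ T) by exact: sigma_algebra_measurable.
have m1 : bounded_measurable measurable (\1_(reached s k) : T -> R).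
  by apply: bounded_measurable_indic; exact: measurable_reached.
have i1 := bounded_measurable_integrable P Ms (@subset_refl _ _) m1.
have -> : fine (P (reached s k)) = \int[P]_w (\1_(reached s k) w).
  by rewrite /Rintegral integral_indic ?setIT//; exact: measurable_reached.
rewrite mulrC -RintegralZl//; apply: le_Rintegral => //.
- apply: (@bounded_measurable_integrable _ _ _ _ measurable) => //.
  by apply: bounded_measurableM => //; exact: bounded_measurable_cst.
- exact: int mN2.
- move=> w _; rewrite indicE; case: (boolP (w \in _)) => [|_]; last by rewrite mulr0 sqr_ge0.
  rewrite inE /reached/= mulr1 => eN.
  by rewrite -[leRHS]real_normK ?num_real// lerXn2r// nnegrE ltW.
Qed.

(** The sum is frozen once the level is reached. *)
Lemma reached_nondecreasing s : nondecreasing_seq (reached s).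
Proof.
apply/nondecreasing_seqP => k; apply/subsetPset => w.
rewrite {1}reachedC /= => nr; rewrite /reached/= indicE memNset// !mul0r addr0.
by rewrite leNgt; apply/negP.
Qed.

(** The expected partial sums of squares are bounded by [K]; [s] is a time at which they are within
    [h] of their supremum. *)
Lemma sum_variances_tail h : 0 < h -> exists s, forall k, \sum_(r < k) v (s + r) <= h.
Proof.
move=> h0; pose u t := \sum_(r < t) v r.
have v0 t : 0 <= v t by apply: Rintegral_ge0 => w _; exact: sqr_ge0.
have uK t : u t <= K.
  pose f (r : 'I_t) w := c r w ^+ 2.
  have mf r : bounded_measurable (F t) (f r).
    apply: bounded_measurable_sqr; apply: bounded_measurable_sub (mc r).
    exact: filtration_sub (ltnW (ltn_ord r)).
  have [mS] := Rintegral_sum P (index_enum 'I_t) (Fs t) (Fm (t := t)) mf.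
  rewrite /u /v /f => <-.
  have -> : K = \int[P]_w (cst K w).
    rewrite Rintegral_cst// -[LHS]mulr1; congr (_ * _).
    by rewrite -[LHS]/(fine 1%E); congr fine; exact/esym/probability_setT.
  apply: le_Rintegral => //; first exact: int mS.
    by apply: (@int 0); exact: bounded_measurable_cst.
  by move=> w _; exact: cK.
have hsu : has_sup (range u).
  by split; [exists (u 0%N); exists 0%N|exists K => _ [t _ <-]].
have [_ [s _ <-] us] := sup_adherent h0 hsu.
exists s => k; have : u (s + k)%N <= sup (range u).
  by apply: ub_le_sup; [have [] := hsu|exists (s + k)%N].
have -> : u (s + k)%N = u s + \sum_(r < k) v (s + r) by rewrite /u big_split_ord.
by move: us; lra.
Qed.

(** Failure for every start [s] lies in all the events [A s], whose probabilities get arbitrarily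
    small. Outside [A s] no stopping occurs and the stopped sum is the full sum. *)
Lemma ae_noise_sum_small : {ae P, forall w, exists s, forall k,
  `|\sum_(r < k) c (s + r) w * xi (s + r) w| < e}.
Proof.
pose A s := \bigcup_k reached s k.
have mA s : measurable (A s).
  by apply: bigcupT_measurable => k; exact: measurable_reached.
have PA h : 0 < h -> exists s, (P (A s) <= h%:E)%E.
  move=> h0; pose C := B ^+ 2 / e ^+ 2.
  have C0 : 0 <= C by rewrite divr_ge0 ?sqr_ge0.
  have [s sP] := sum_variances_tail (divr_gt0 h0 (ltr_wpDl C0 ltr01)).
  exists s; have cvgA : (P \o reached s) @ \oo --> P (A s).
    apply: nondecreasing_cvg_mu => [k||]; first exact: measurable_reached.
      exact: mA.
    exact: reached_nondecreasing.
  rewrite -(cvg_lim _ cvgA)//; apply: lime_le; first by apply/cvg_ex; eexists; exact: cvgA.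
  apply: nearW => k /=; rewrite -[P _]fineK; last first.
    by apply: fin_num_measure; exact: measurable_reached.
  rewrite lee_fin (le_trans (reached_chebyshev s k))// -/C.
  apply: (@le_trans _ _ (C * (h / (C + 1)))); first by rewrite ler_wpM2l.
  by rewrite mulrA ler_pdivrMr ?ltr_wpDl// mulrC ler_wpM2l ?ltW//; lra.
exists (\bigcap_s A s); split.
- exact: bigcapT_measurable.
- apply/eqP; rewrite eq_le measure_ge0 andbT; apply/lee_addgt0Pr => h h0.
  have [s sP] := PA _ h0; rewrite add0e; apply: le_trans sP.
  apply: le_measure; rewrite ?inE//; first exact: bigcapT_measurable.
  exact: bigcap_inf.
- move=> w /=; apply: contra_notP => nA.
  have [s nAs] : exists s, ~ A s w.
    by apply: contrapT => /forallNP nn; apply: nA => s _; exact: contrapT (nn s).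
  exists s; have run k : running s k w.
    by apply: contrapT => nr; apply: nAs; exists k => //; rewrite reachedC.
  move=> k; have -> : \sum_(r < k) c (s + r) w * xi (s + r) w = stopped_sum s k w.
    elim: k => [|k IHk]; first by rewrite big_ord0.
    rewrite big_ord_recr/= IHk indicE mem_set ?mul1r//.
    exact: run.
  exact: run.
Qed.

End NoiseSums.

Fixpoint averaged (R : nzRingType) (a x : nat -> R) t : R :=
  if t is t'.+1 then (1 - a t') * averaged a x t' + a t' * x t' else 0.

(* Subtracting from the average the partial sums of the noise from time [s] on
   leaves a recursion without noise. *)
Lemma averaged_small (R : realType) (a x : nat -> R) h : 0 < h ->
  (forall t, 0 <= a t <= 1) -> (fun N => \sum_(t < N) a t) @ \oo --> +oo ->
  (exists s, forall k, `|\sum_(r < k) a (s + r)%N * x (s + r)%N| < h) ->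
  exists t0, forall t, (t0 <= t)%N -> `|averaged a x t| <= 3 * h.
Proof.
move=> h0 a01 ay [s xs].
pose W k := \sum_(r < k) a (s + r)%N * x (s + r)%N.
pose z k := averaged a x (s + k)%N - W k.
have zS k : `|z k.+1| <= (1 - a (s + k)%N) * `|z k| + a (s + k)%N * h.
  have /andP[a0 a1] := a01 (s + k)%N.
  have -> : z k.+1 = (1 - a (s + k)%N) * z k - a (s + k)%N * W k.
    by rewrite /z /W addnS big_ord_recr/=; ring.
  rewrite (le_trans (ler_normB _ _))// !normrM ger0_norm ?subr_ge0// (ger0_norm a0).
  by rewrite lerD2l ler_wpM2l// ltW// xs.
(* While [z] exceeds [2 * h] in absolute value, each step lowers it by at least [h] times the
   stepsize; the divergence of the stepsizes ends this. *)
have [k0 zk0] : exists k, `|z k| <= 2 * h.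
  apply: contrapT => /forallNP nz.
  have {}nz k : 2 * h < `|z k| by rewrite ltNge; apply/negP/nz.
  have zle k : `|z k| <= `|z 0%N| - h * \sum_(r < k) a (s + r)%N.
    elim: k => [|k IHk]; first by rewrite big_ord0 mulr0 subr0.
    rewrite big_ord_recr/=; have /andP[a0 a1] := a01 (s + k)%N.
    have := zS k; have : a (s + k)%N * h <= a (s + k)%N * (`|z k| - h).
      by rewrite ler_wpM2l//; have := nz k; lra.
    by move: IHk; lra.
  have /cvgryPge/(_ (\sum_(t < s) a t + `|z 0%N| / h))[N _ NP] := ay.
  have := NP (s + N)%N (leq_addl _ _); rewrite /= big_split_ord/= lerD2l ler_pdivrMr//.
  by have := zle N; have := nz N; rewrite mulrC; lra.
(* The level [2 * h] is never left again; adding back the noise sum costs one more [h]. *)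
have zle k : `|z (k0 + k)%N| <= 2 * h.
  elim: k => [|k IHk]; first by rewrite addn0.
  rewrite addnS (le_trans (zS _))//; have /andP[a0 a1] := a01 (s + (k0 + k))%N.
  have : (1 - a (s + (k0 + k))%N) * `|z (k0 + k)%N| <= (1 - a (s + (k0 + k))%N) * (2 * h).
    by rewrite ler_wpM2l// subr_ge0.
  have : a (s + (k0 + k))%N * h <= a (s + (k0 + k))%N * (2 * h) by rewrite ler_wpM2l//; lra.
  by lra.
exists (s + k0)%N => t st.
have := zle (t - (s + k0))%N; have := xs (k0 + (t - (s + k0)))%N.
rewrite -/(W _) /z addnA subnKC// => Wh zh.
rewrite -[averaged a x t](subrK (W (k0 + (t - (s + k0)))%N)).
by rewrite (le_trans (ler_normD _ _))//; lra.
Qed.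

(** * Averages with random stepsizes *)

Section RobbinsMonro.
Context d (T : measurableType d) (R : realType) (P : probability T R).
Variables (F : nat -> set (set T)) (HF : filtration F).
Variables (J : finType) (gam : nat -> T -> R) (j : nat -> T -> J) (q phi : J -> R).
Hypothesis gam01 : forall t w, 0 <= gam t w <= 1.
Hypothesis gam_meas : forall t, measurable_wrt_R (F t) (gam t).
Hypothesis j_meas : forall t, measurable_wrt_discrete (F t.+1) (j t).
Hypothesis q_ge0 : forall k, 0 <= q k.
Hypothesis j_law : forall t k A, F t A ->
  P (A `&` [set w | j t w = k]) = ((q k)%:E * P A)%E.

Let Fs t : sigma_algebra setT (F t). Proof. by have [+ _] := HF. Qed.
Let Fm t : F t `<=` measurable. Proof. by have [_ [+ _]] := HF. Qed.

Let xi t w := phi (j t w) - \sum_k q k * phi k.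

Let mgam t : bounded_measurable (F t) (gam t).
Proof.
split; first exact/(measurable_wrt_RP _ (Fs t)).
by exists 1 => w; have /andP[g0 g1] := gam01 t w; rewrite ger0_norm.
Qed.

Let mxi t : bounded_measurable (F t.+1) (xi t).
Proof.
apply: bounded_measurableD; last exact: bounded_measurable_cst.
have phiE : (fun w => phi (j t w)) =
    (fun w => \sum_k phi k * \1_[set w | j t w = k] w).
  apply/funext => w; rewrite (bigD1 (j t w))// big1 => [|k kj]; rewrite indic_fiberE.
    by rewrite eqxx mulr1; exact/esym/addr0.
  by rewrite eq_sym (negPf kj) mulr0.
have mf k : bounded_measurable (F t.+1) (fun w => phi k * \1_[set w | j t w = k] w).
  apply: bounded_measurableM; first exact: bounded_measurable_cst.
  by apply: bounded_measurable_indic; exact: j_meas.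
by rewrite phiE; have [] := Rintegral_sum P (index_enum J) (Fs t.+1) (Fm (t := t.+1)) mf.
Qed.

Let xi_bound t w : `|xi t w| <= \sum_k `|phi k| + `|\sum_k q k * phi k|.
Proof.
rewrite (le_trans (ler_normB _ _))// lerD2r (bigD1 (j t w))//= lerDl.
exact: sumr_ge0.
Qed.

Let xi_mean0 t X : bounded_measurable (F t) X -> \int[P]_w (X w * xi t w) = 0.
Proof.
move=> mX; apply: (Rintegral_centered_noise phi (Fs t) (Fm (t := t)) mX) => //.
- by move=> k; apply: (Fm (t := t.+1)); exact: j_meas.
- by move=> k A; exact: j_law.
Qed.

Let sqsum t w : R := \sum_(r < t) gam r w ^+ 2.

(** The squares of the stepsizes are summable only path by path; cutting off gives the uniform bound
    [K]. The test at time [t] includes [gam t], which is known at that time. *)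
Let trunc_gam (K : nat) t w := gam t w * \1_[set w | sqsum t.+1 w <= K%:R] w.

Let mtrunc K t : bounded_measurable (F t) (trunc_gam K t).
Proof.
apply: bounded_measurableM => //; apply: bounded_measurable_indic.
have mf (r : 'I_t.+1) : bounded_measurable (F t) (fun w => gam r w ^+ 2).
  apply/bounded_measurable_sqr/(bounded_measurable_sub _ (mgam r)).
  by apply: (filtration_sub HF); rewrite -ltnS.
have [[mS _] _] := Rintegral_sum P (index_enum 'I_t.+1) (Fs t) (Fm (t := t)) mf.
have -> : [set w | sqsum t.+1 w <= K%:R] = sqsum t.+1 @^-1` `]-oo, K%:R]%classic.
  by apply/seteqP; split => w /=; rewrite in_itv.
apply: (measurable_wrt_RP _ (Fs t)).2; last exact: measurable_itv.
exact: mS.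
Qed.

Let trunc_sqsum K t w : \sum_(r < t) trunc_gam K r w ^+ 2 <= K%:R.
Proof.
elim: t => [|t IHt]; first by rewrite big_ord0.
have [St|St] := leP (sqsum t.+1 w) K%:R.
  apply: le_trans St; apply: ler_sum => r _; rewrite /trunc_gam indicE.
  case: (_ \in _); first by rewrite mulr1.
  by rewrite mulr0 expr0n sqr_ge0.
rewrite big_ord_recr/= /trunc_gam indicE memNset ?mulr0 ?expr0n ?addr0//=.
by apply/negP; rewrite -ltNge.
Qed.

(** Almost surely the tails are small for all integers [K] at once; on a path with summable squares
    some [K] makes the truncation inactive. The level [e / 3] offsets the factor 3 of
    [averaged_small]. *)
Lemma ae_averaged_small e : 0 < e -> {ae P, forall w,
  (fun N => \sum_(t < N) gam t w) @ \oo --> +oo ->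
  cvgn (fun N => \sum_(t < N) gam t w ^+ 2) ->
  exists t0, forall t, (t0 <= t)%N ->
    `|averaged (gam^~ w) (fun t => phi (j t w) - \sum_k q k * phi k) t| <= e}.
Proof.
move=> e0; have h0 : 0 < e / 3 by rewrite divr_gt0.
have aeK (K : nat) := ae_noise_sum_small HF (mtrunc K) mxi xi_bound xi_mean0
  (trunc_sqsum K) h0.
have := ae_foralln aeK; apply: filterS => w small gy g2.
have [M [_ MP]] := cvg_seq_bounded g2.
pose K := (Num.truncn (`|M| + 1)).+1.
have SK t : sqsum t w <= K%:R.
  apply: le_trans (ltW (truncnS_gt (`|M| + 1))); apply: le_trans (ler_norm _) _.
  by apply: (MP (`|M| + 1)) => //; rewrite ltr_pwDr// ler_norm.
have truncE t : trunc_gam K t w = gam t w.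
  by rewrite /trunc_gam indicE mem_set ?mulr1//=.
have [s sP] := small K.
have [|t0 tP] := @averaged_small _ (gam^~ w) (xi^~ w) _ h0 (fun t => gam01 t w) gy.
  exists s => k; under eq_bigr do rewrite -truncE; exact: sP.
exists t0 => t /tP; rewrite [3 * _]mulrC divfK//.
Qed.

End RobbinsMonro.

(** * Boundedness of the iterates *)

(** This is a statement about one path. The bound [m + E - C] is proved for all times up to [t]
    together, since a delayed value may come from any of them; [valP] consumes the weaker
    [m - e - C], free of the noise. *)
Lemma iterates_bounded_below (R : realType) (L : finType) (S : Type)
    (Q a : nat -> L -> R) (tau : nat -> L -> L -> nat) (s : nat -> L -> S)
    (G : L -> S -> R) (h : S -> R) (val : (L -> R) -> S -> R) (m : L -> R) (e : R) :
  (forall t l, 0 <= a t l <= 1) -> (forall t l l', (tau t l l' <= t)%N) ->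
  (forall t l, Q t.+1 l = (1 - a t l) * Q t l +
     a t l * (G l (s t l) + val (fun l' => Q (tau t l l') l') (s t l))) ->
  (forall X C, 0 <= C -> (forall l, m l - e - C <= X l) ->
     forall x, h x - C <= val X x) ->
  0 <= e ->
  (forall l, exists t0, forall t, (t0 <= t)%N ->
     `|averaged (a^~ l) (fun t => G l (s t l) + h (s t l) - m l) t| <= e) ->
  exists C, forall t l, C <= Q t l.
Proof.
move=> a01 tau_le QS valP e0 /choice[t0 t0P].
pose E t l := averaged (a^~ l) (fun t => G l (s t l) + h (s t l) - m l) t.
pose N := (\max_l t0 l)%N.
have EN t l : (N <= t)%N -> `|E t l| <= e.
  by move=> Nt; apply: t0P; rewrite (leq_trans _ Nt)// leq_bigmax.
(* [C] dominates everything up to time [N], before which [E] need not be small. *)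
pose C := \sum_(t < N.+1) \sum_l (`|m l| + `|E t l| + e + `|Q t l|).
have term_ge0 t l : 0 <= `|m l| + `|E t l| + e + `|Q t l| by rewrite !addr_ge0.
have C0 : 0 <= C by do 2 apply: sumr_ge0 => ? _.
have CP t l : (t <= N)%N -> `|m l| + `|E t l| + e + `|Q t l| <= C.
  move=> tN; apply: (@le_trans _ _ (\sum_l (`|m l| + `|E t l| + e + `|Q t l|))).
    by rewrite (bigD1 l)//= lerDl sumr_ge0.
  rewrite /C (bigD1 (Ordinal (tN : (t < N.+1)%N)))//= lerDl sumr_ge0// => ? _.
  exact: sumr_ge0.
have below t l : m l + E t l - C <= Q t l -> m l - e - C <= Q t l.
  have [tN _|Nt] := leqP t N; last first.
    by have := EN t l (ltnW Nt); rewrite ler_norml => /andP[+ _]; lra.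
  have := CP t l tN; have := ler_norm (m l); have := normr_ge0 (E t l).
  by have := ler_norm (- Q t l); rewrite normrN; lra.
have QE t : forall k, (k <= t)%N -> forall l, m l + E k l - C <= Q k l.
  elim: t => [k|t IHt k].
    rewrite leqn0 => /eqP-> l; have := CP 0%N l isT.
    have := ler_norm (m l); have := ler_norm (E 0%N l).
    by have := ler_norm (- Q 0%N l); rewrite normrN; lra.
  rewrite leq_eqVlt => /orP[/eqP->|]; last by rewrite ltnS; exact: IHt.
  move=> l; rewrite QS; have /andP[al0 al1] := a01 t l.
  have valS : h (s t l) - C <= val (fun l' => Q (tau t l l') l') (s t l).
    by apply: valP => // l'; apply: below; exact: IHt.
  have -> : E t.+1 l = (1 - a t l) * E t l + a t l * (G l (s t l) + h (s t l) - m l) by [].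
  have IHtl := IHt t (leqnn t) l.
  (* The recursion of [E] makes this convex combination exactly [m l + E t.+1 l - C]. *)
  apply: (@le_trans _ _ ((1 - a t l) * (m l + E t l - C) +
    a t l * (G l (s t l) + (h (s t l) - C)))).
    by rewrite le_eqVlt; apply/orP; left; apply/eqP; ring.
  by rewrite lerD// ler_wpM2l ?subr_ge0// lerD2l.
exists (- (C + e + \sum_l `|m l|)) => t l.
apply: le_trans (below t l (QE t t (leqnn t) l)).
have : `|m l| <= \sum_l `|m l| by rewrite (bigD1 l)//= lerDl sumr_ge0.
by have := ler_norm (- m l); rewrite normrN; lra.
Qed.

(** * Bounds on the value of a matrix game *)

Section MinMax.
Variables (R : realType) (n : nat) (U V : 'I_n -> finType).
Implicit Types (X : Ridx U V -> R) (i : 'I_n).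

Let payoff X i (rho : {ffun U i -> R}) (sigma : {ffun V i -> R}) :=
  \sum_u \sum_v rho u * sigma v * X (existT _ i (u, v)).

Let payoffE X i (rho : {ffun U i -> R}) (sigma : {ffun V i -> R}) :
  payoff X rho sigma = \sum_u rho u * \sum_v sigma v * X (existT _ i (u, v)).
Proof.
by apply: eq_bigr => u _; rewrite mulr_sumr; apply: eq_bigr => v _; rewrite mulrA.
Qed.

Let payoffE2 X i (rho : {ffun U i -> R}) (sigma : {ffun V i -> R}) :
  payoff X rho sigma = \sum_v sigma v * \sum_u rho u * X (existT _ i (u, v)).
Proof.
rewrite /payoff exchange_big; apply: eq_bigr => v _; rewrite mulr_sumr.
by apply: eq_bigr => u _; rewrite mulrCA mulrA.
Qed.

Lemma average_ge (A : finType) (w : {ffun A -> R}) (f : A -> R) x : isDist w ->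
  (forall a, x <= f a) -> x <= \sum_a w a * f a.
Proof.
move=> wP xf; rewrite -lerN2 -sumrN; under eq_bigr do rewrite -mulrN.
by apply: average_le => // a; rewrite lerN2.
Qed.

Let bound X i := \sum_u \sum_v `|X (existT _ i (u, v))|.

Let boundP X i (u : U i) (v : V i) : `|X (existT _ i (u, v))| <= bound X i.
Proof.
apply: (@le_trans _ _ (\sum_v `|X (existT _ i (u, v))|)).
  by rewrite (bigD1 v)//= lerDl sumr_ge0.
by rewrite /bound (bigD1 u)//= lerDl sumr_ge0// => u' _; exact: sumr_ge0.
Qed.

Let payoff_le X i (rho : {ffun U i -> R}) (sigma : {ffun V i -> R}) :
  isDist rho -> isDist sigma -> payoff X rho sigma <= bound X i.
Proof.
move=> rhoP sigmaP; rewrite payoffE; apply: average_le => // u.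
by apply: average_le => // v; rewrite (le_trans (ler_norm _))// boundP.
Qed.

Let payoff_ge X i (rho : {ffun U i -> R}) (sigma : {ffun V i -> R}) :
  isDist rho -> isDist sigma -> - bound X i <= payoff X rho sigma.
Proof.
move=> rhoP sigmaP; rewrite payoffE; apply: average_ge => // u.
apply: average_ge => // v; rewrite lerNl (le_trans _ (boundP X u v))//.
by rewrite -normrN ler_norm.
Qed.

Let payoff_le_sup X i (rho : {ffun U i -> R}) (sigma : {ffun V i -> R}) :
  isDist rho -> isDist sigma ->
  payoff X rho sigma <=
    sup [set y | exists sigma : {ffun V i -> R}, isDist sigma /\ y = payoff X rho sigma].
Proof.
move=> rhoP sigmaP; apply: ub_le_sup; last by exists sigma.
by exists (bound X i) => _ [sg [sgP ->]]; exact: payoff_le.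
Qed.

(** The fixed [sigma] answers every [rho]. The distribution [rho0] shows that the infimum is over a
    nonempty set. *)
Lemma minmax_val_ge X i (rho0 : {ffun U i -> R}) (sigma : {ffun V i -> R}) x :
  isDist rho0 -> isDist sigma ->
  (forall u, x <= \sum_v sigma v * X (existT _ i (u, v))) ->
  x <= minmax_val U V X (Some i).
Proof.
move=> rho0P sigmaP xX; apply: lb_le_inf; first by eexists; exists rho0.
move=> _ [rho [rhoP ->]]; apply: le_trans (payoff_le_sup X rhoP sigmaP).
by rewrite payoffE; exact: average_ge.
Qed.

(** The fixed [rho] is a candidate for the infimum. The distribution [sigma0] makes the inner sets
    nonempty and bounds the suprema from below. *)
Lemma minmax_val_le X i (rho : {ffun U i -> R}) (sigma0 : {ffun V i -> R}) x :
  isDist rho -> isDist sigma0 ->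
  (forall v, \sum_u rho u * X (existT _ i (u, v)) <= x) ->
  minmax_val U V X (Some i) <= x.
Proof.
move=> rhoP sigma0P xX.
apply: (@le_trans _ _ (sup [set y | exists sigma : {ffun V i -> R},
    isDist sigma /\ y = payoff X rho sigma])).
  apply: ge_inf; last by exists rho.
  exists (- bound X i) => _ [rho' [rho'P ->]].
  exact: le_trans (payoff_ge X rho'P sigma0P) (payoff_le_sup X rho'P sigma0P).
apply: ge_sup; first by eexists; exists sigma0.
by move=> _ [sigma [sigmaP ->]]; rewrite payoffE2; exact: average_le.
Qed.

End MinMax.

(** * Two-sided bounds on almost every path *)

Unset Implicit Arguments.

Theorem theorem3p1 (R : realType) (n : nat) (U V : 'I_n -> finType)
  (p g : forall i : 'I_n, U i -> V i -> option 'I_n -> R)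
  (Hp : transition_kernel p)
  (Hssp : SSP_assumption p g)
  (d : measure_display) (T : measurableType d) (P : probability T R)
  (F : nat -> set (set T)) (HF : filtration F)
  (Q : nat -> T -> Ridx U V -> R)
  (gamma : nat -> Ridx U V -> T -> R)
  (tau : nat -> Ridx U V -> Ridx U V -> T -> nat)
  (jsucc : nat -> Ridx U V -> T -> option 'I_n)
  (* Q-learning iteration *)
  (Htau_le : forall t l l' w, (tau t l l' w <= t)%N)
  (Hgamma01 : forall t l w, 0 <= gamma t l w <= 1)
  (Hiter : forall t (l : Ridx U V) w,
     Q t.+1 w l =
       (1 - gamma t l w) * Q t w l +
       gamma t l w * (g (projT1 l) (projT2 l).1 (projT2 l).2 (jsucc t l w) +
         minmax_val U V (fun l' => Q (tau t l l' w) w l') (jsucc t l w)))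
  (* (i) *)
  (HQ0 : forall l, measurable_wrt_R (F 0%N) (fun w => Q 0%N w l))
  (* (ii) *)
  (Hgamma_meas : forall t l, measurable_wrt_R (F t) (gamma t l))
  (Htau_meas : forall t l l', measurable_wrt_discrete (F t) (tau t l l'))
  (* (iii) *)
  (Hj_meas : forall t l, measurable_wrt_discrete (F t.+1) (jsucc t l))
  (Hj_law : forall t (l : Ridx U V) (j : option 'I_n) (A : set T), F t A ->
     P (A `&` [set w | jsucc t l w = j]) =
       ((p (projT1 l) (projT2 l).1 (projT2 l).2 j)%:E * P A)%E)
  (* (v) *)
  (Hstep : {ae P, forall w, forall l : Ridx U V,
     ((fun N => \sum_(t < N) gamma t l w) @ \oo --> +oo) /\
     cvgn (fun N => \sum_(t < N) gamma t l w ^+ 2)}) :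
  {ae P, forall w, exists M : R, forall t l, `|Q t w l| <= M}.
Proof.
(* These policies serve as witnesses that each control set carries a distribution. *)
have [mub [mubP _]] := Hssp.1.
have [nub [nubP _]] := Hssp.2.1.
have [nu [h1 [e1 [nuP e1_gt0 h1P]]]] := player1_subsolution Hp Hssp.
have [mu [h2 [e2 [muP e2_gt0 h2P]]]] := player2_subsolution Hp Hssp.
pose pl (l : Ridx U V) := p (projT1 l) (projT2 l).1 (projT2 l).2.
pose gl (l : Ridx U V) := g (projT1 l) (projT2 l).1 (projT2 l).2.
have small (phi : Ridx U V -> option 'I_n -> R) e : 0 < e ->
    {ae P, forall w, forall l, exists t0, forall t, (t0 <= t)%N ->
      `|averaged (fun t => gamma t l w)
          (fun t => phi l (jsucc t l w) - \sum_k pl l k * phi l k) t| <= e}.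
  move=> e0; have aeL (l : Ridx U V) := ae_averaged_small HF (phi l) (fun t w => Hgamma01 t l w)
    (fun t => Hgamma_meas t l) (fun t => Hj_meas t l)
    (fun k => (Hp _ (projT2 l).1 (projT2 l).2).1 k)
    (fun t k A => Hj_law t l k A) e0.
  apply: filterS2 Hstep (filter_forall _ aeL) => w step small_w l.
  by have [s1 s2] := step l; exact: small_w.
have small1 := small (fun l j => gl l j + oapp h1 0 j) _ e1_gt0.
have small2 := small (fun l j => - gl l j + oapp h2 0 j) _ e2_gt0.
apply: filterS2 small1 small2 => w w1 w2.
have [C1 C1P] : exists C, forall t l, C <= Q t w l.
  apply: (@iterates_bounded_below _ _ _ (fun t => Q t w) (fun t l => gamma t l w)
    (fun t l l' => tau t l l' w) (fun t l => jsucc t l w) gl (oapp h1 0)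
    (minmax_val U V) _ e1 _ _ _ _ (ltW e1_gt0) w1) => // X C C0 XP [i|]; last first.
    by rewrite /= sub0r oppr_le0.
  (* Player II answers with [nu]; the margin [e1] of the subsolution cancels the loss [e1] in the
     bound on [X]. *)
  apply: (minmax_val_ge (mubP i) (nuP i)) => u.
  apply: (@le_trans _ _ (\sum_v nu i v * (\sum_j p i u v j * (g i u v j + oapp h1 0 j) - e1 - C))).
    under eq_bigr do rewrite -addrA mulrDr.
    rewrite big_split/= -mulr_suml (nuP i).2 mul1r.
    by have := h1P i u; lra.
  by apply: ler_sum => v _; rewrite ler_wpM2l ?(nuP i).1//; exact: (XP (existT _ i (u, v))).
(* The upper bound is a lower bound for [- Q], which follows the same recursion with costs [- g] and
   the value map [X] to minus the minmax value of [- X]. *)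
have [C2 C2P] : exists C, forall t l, C <= - Q t w l.
  apply: (@iterates_bounded_below _ _ _ (fun t l => - Q t w l) (fun t l => gamma t l w)
    (fun t l l' => tau t l l' w) (fun t l => jsucc t l w) (fun l j => - gl l j) (oapp h2 0)
    (fun X j => - minmax_val U V (fun l => - X l) j) _ e2 _ _ _ _ (ltW e2_gt0) w2) => //.
    move=> t l; rewrite Hiter (_ : (fun l' => - - Q (tau t l l' w) w l') =
      (fun l' => Q (tau t l l' w) w l')); first by rewrite /gl; ring.
    by apply/funext => l'; rewrite opprK.
  move=> X C C0 XP [i|]; last by rewrite /= oppr0 sub0r oppr_le0.
  rewrite lerNr; apply: (minmax_val_le (muP i) (nubP i)) => v.
  under eq_bigr do rewrite mulrN.
  rewrite sumrN lerN2.
  apply: (@le_trans _ _ (\sum_u mu i u * (\sum_j p i u v j * (- g i u v j + oapp h2 0 j) - e2 - C))).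
    under eq_bigr do rewrite -addrA mulrDr.
    rewrite big_split/= -mulr_suml (muP i).2 mul1r.
    by have := h2P i v; lra.
  by apply: ler_sum => u _; rewrite ler_wpM2l ?(muP i).1//; exact: (XP (existT _ i (u, v))).
exists (`|C1| + `|C2|) => t l; rewrite ler_norml.
have := C1P t l; have := C2P t l; have := ler_norm (- C1); have := ler_norm (- C2).
have := normr_ge0 C1; have := normr_ge0 C2; rewrite !normrN.
by move=> *; apply/andP; split; lra.
Qed.
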